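(* Suppose the design matrix $\mathrm{A}$ has full rank $d$ and that conditions (A0), (A1) and (A2) (stated in the context) hold. Let $F_{\mathrm{V}}$ be a face of the convex support $C_{\mathrm V}$, of dimension $d_F$, and let $F$ and $\mathcal{F}$ be the corresponding face of the marginal cone and facial set (see context). Then: (i) For any $\theta\in\mathbb{R}^d$, the set $\theta_{\mathcal{N}_F}$ is an affine subspace of $\mathbb{R}^d$ of dimension $m+\dim(\mathcal{L}_F)=d-d_F$. The set $\Theta_{\mathcal{N}_F}$ is a $d_F$-dimensional vector space isomorphic to $\pi_{\mathcal{F}}(\mathcal{M}\ominus\mathcal{N})$ and is comprised of parallel $(d-d_F)$-dimensional affine subspaces of $\mathbb{R}^d$. (ii) The extended family corresponding to $F_{\mathrm{V}}$ is nonidentifiable: any two points $\theta_1\stackrel{\mathcal{N}_F}{\sim}\theta_2$ specify the same distribution. In fact, the family is parametrized by $\Theta_{\mathcal{N}_F}$ (distinct classes specify distinct distributions), or, equivalently, by $\pi_{\mathcal{F}}(\mathcal{M}\ominus\mathcal{N})$. Therefore, it is of order $d_F$.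
   Context: Setting. $\mathcal{I}$ is a finite set; $\mathbb{R}^{\mathcal{I}}$ carries the standard inner product $(\cdot,\cdot)$. $\mathrm{A}$ (the design matrix) is a real $|\mathcal{I}|\times d$ matrix with nonzero rows $\mathbf{a}_i^\top$, and $\mathcal{M}\subset\mathbb{R}^{\mathcal{I}}$ is its column span. $\mathcal{N}\subsetneq\mathcal{M}$ is a linear subspace of dimension $m$ (the sampling subspace), and $\mathrm{V}$ is an $|\mathcal{I}|\times m$ matrix whose columns form a basis of $\mathcal{N}$. $\mathcal{M}\ominus\mathcal{N}=\mathcal{M}\cap\mathcal{N}^\perp$. For $\mathcal{F}\subseteq\mathcal{I}$, $\pi_{\mathcal{F}}:\mathbb{R}^{\mathcal{I}}\to\mathbb{R}^{\mathcal{F}}$ is the coordinate projection. $S(\mathrm{V})=\{\mathbf{x}\in\mathbb{N}^{\mathcal{I}}: \mathrm{V}^\top\mathbf{x}=\mathbf{1}\}$ ($\mathbb{N}$ includes $0$; $\mathbf 1$ is the all-ones vector; if $m=0$ there is no constraint). $\nu_{\mathrm V}$ is the measure on $\mathbb{N}^{\mathcal{I}}$ giving mass $\prod_i 1/\mathbf{x}(i)!$ to each $\mathbf{x}\in S(\mathrm{V})$ and $0$ elsewhere. The original exponential family has densities $p_\theta(\mathbf{x})=\exp\{(\mathrm{A}^\top\mathbf{x},\theta)-\psi(\theta)\}$ with respect to $\nu_{\mathrm V}$, $\theta\in\mathbb{R}^d$, with $\psi$ the normalizing log-partition function. Let $\mu_{\mathrm V}$ be the image of $\nu_{\mathrm V}$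 under $\mathbf{x}\mapsto\mathrm{A}^\top\mathbf{x}$ (the base measure for the sufficient statistics $\mathbf{t}=\mathrm A^\top\mathbf{n}$). (A0) $S(\mathrm{V})\neq\varnothing$. (A1) There is no $\gamma\in\mathcal{N}^\perp\setminus\{0\}$ such that $(\gamma,\mathbf{n})$ is constant almost everywhere with respect to $\nu_{\mathrm V}$; in particular, for no cell $i$ is $\mathbf{n}(i)=0$ almost everywhere $\nu_{\mathrm V}$. (A2) $\{\mathbf{x}\in\mathbb{R}^{\mathcal{I}}_{\ge0}:\mathrm{V}^\top\mathbf{x}=\mathbf{1}\}=\mathrm{conv}(S(\mathrm{V}))$. The convex support $C_{\mathrm V}\subset\mathbb{R}^d$ is the closure of $\mathrm{conv}\{\mathrm{A}^\top\mathbf{x}:\mathbf{x}\in S(\mathrm{V})\}$, a $(d-m)$-dimensional polyhedron. The marginal cone $C_{\mathrm{A}}\subset\mathbb{R}^d$ is the polyhedral cone spanned by the vectors $\mathbf{a}_i$, $i\in\mathcal{I}$. For a (nonempty) face $F_{\mathrm V}$ of $C_{\mathrm V}$ of dimension $d_F$, $F$ denotes the face of $C_{\mathrm A}$ of dimension $m+d_F$ containing $F_{\mathrm V}$, and $\mathcal{F}=\{i\in\mathcal{I}:\mathbf{a}_i\in F\}$ is its facial set. $N_F$ is the normal cone to $C_{\mathrm A}$ at $F$, i.e. the set of $\mathbf{c}\in\mathbb{R}^d$ such that $(\mathbf{c},\cdot)$ attains its maximum over $C_{\mathrm A}$ at every point of $F$; $\mathcal{L}_F\subset\mathbb{R}^d$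 is the linear span of $N_F$, so $\dim(\mathcal{L}_F)=d-m-d_F$. Let $\mathcal{Z}=\{\zeta\in\mathbb{R}^d:\mathrm{A}\zeta\in\mathcal{N}\}$ and $\mathcal{N}_F=\{\mathrm{A}\beta:\beta\in\mathcal{Z}+\mathcal{L}_F\}$. Write $\theta_1\stackrel{\mathcal{N}_F}{\sim}\theta_2$ iff $\theta_1-\theta_2\in\mathcal{Z}+\mathcal{L}_F$; $\theta_{\mathcal{N}_F}$ is the equivalence class of $\theta$, and $\Theta_{\mathcal{N}_F}=\{\theta_{\mathcal{N}_F}:\theta\in\mathbb{R}^d\}$, with the quotient vector space structure. The extended family corresponding to $F_{\mathrm V}$ is the exponential family with base measure $\mu^{F}_{\mathrm V}$, the restriction of $\mu_{\mathrm V}$ to $F_{\mathrm V}$, and densities $q^F_\theta(\mathbf{t})=\exp\{(\mathbf{t},\theta)-\psi^F(\theta)\}$, $\theta\in\mathbb{R}^d$, where $\psi^F(\theta)=\log\int\exp\{(\mathbf{t},\theta)\}\,d\mu^F_{\mathrm V}(\mathbf{t})$. The order of an exponential family is the smallest dimension of the sufficient statistic over all its exponential family representations.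
   Formalization: As printed, the isomorphism with and parametrization by π_F(M⊖N) are false; π_F(M⊖N_F) is used, and π_F(M⊖N) is shown to cover the family, one-to-one exactly when A L_F ⊥ N. F is assumed to be the only face of C_A of dimension m+d_F containing F_V. *)

(* Defs.v *)
From HB Require Import structures.
From mathcomp Require Import all_boot all_order all_algebra.
From mathcomp Require Import all_classical all_reals all_analysis.

Set Implicit Arguments.
Unset Strict Implicit.
Unset Printing Implicit Defensive.

Import Order.TTheory GRing.Theory Num.Theory.
Import VectorInternalTheory numFieldNormedType.Exports.

Local Open Scope classical_set_scope.
Local Open Scope ring_scope.

Section Quotient.
Variables (K : fieldType) (E : vectType K) (W : {vspace E}).
Implicit Types x y z : E.

Definition sim : rel E := fun x y => x - y \in W.

Lemma sim_refl : reflexive sim.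
Proof. by move=> x; rewrite /sim subrr mem0v. Qed.

Lemma sim_sym : symmetric sim.
Proof. by move=> x y; rewrite /sim -opprB memvN. Qed.

Lemma sim_trans : transitive sim.
Proof.
by move=> y x z xy yz; rewrite /sim -(subrKA y) memvD.
Qed.

Canonical sim_equiv := EquivRel sim sim_refl sim_sym sim_trans.

Definition quotv : Type := {eq_quot sim}%qT.
HB.instance Definition _ := Choice.on quotv.
HB.instance Definition _ := EqQuotient.on quotv.

Local Notation cls := (\pi_quotv)%qT.

Lemma quotvP x y : reflect (cls x = cls y) (x - y \in W).
Proof. by apply: (iffP idP) => [h|/eqmodP//]; apply/eqmodP. Qed.

Definition addq (c c' : quotv) : quotv := cls (repr c + repr c').
Definition oppq (c : quotv) : quotv := cls (- repr c).
Definition scaleq (a : K) (c : quotv) : quotv := cls (a *: repr c).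

Lemma repr_sim x : repr (cls x) - x \in W.
Proof. by apply/quotvP; rewrite reprK. Qed.

Lemma addqE x y : addq (cls x) (cls y) = cls (x + y).
Proof. by apply/quotvP; rewrite opprD addrACA memvD ?repr_sim. Qed.

Lemma oppqE x : oppq (cls x) = cls (- x).
Proof. by apply/quotvP; rewrite -opprD memvN repr_sim. Qed.

Lemma scaleqE a x : scaleq a (cls x) = cls (a *: x).
Proof. by apply/quotvP; rewrite -scalerBr memvZ ?repr_sim. Qed.

Let quotvI (P : quotv -> Prop) : (forall x, P (cls x)) -> forall c, P c.
Proof. by move=> h c; rewrite -[c]reprK. Qed.

Lemma addqA : associative addq.
Proof.
elim/quotvI => x; elim/quotvI => y; elim/quotvI => z.
by rewrite !addqE addrA.
Qed.

Lemma addqC : commutative addq.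
Proof. by elim/quotvI => x; elim/quotvI => y; rewrite !addqE addrC. Qed.

Lemma add0q : left_id (cls 0) addq.
Proof. by elim/quotvI => x; rewrite addqE add0r. Qed.

Lemma addNq : left_inverse (cls 0) oppq addq.
Proof. by elim/quotvI => x; rewrite oppqE addqE addNr. Qed.

HB.instance Definition _ := GRing.isZmodule.Build quotv addqA addqC add0q addNq.

Lemma scaleqA a b c : scaleq a (scaleq b c) = scaleq (a * b) c.
Proof. by elim/quotvI: c => x; rewrite !scaleqE scalerA. Qed.

Lemma scale1q : left_id 1 scaleq.
Proof. by elim/quotvI => x; rewrite scaleqE scale1r. Qed.

Lemma scaleqDr : right_distributive scaleq +%R.
Proof.
move=> a; elim/quotvI => x; elim/quotvI => y.
rewrite -[cls x + cls y]/(addq _ _) -[RHS]/(addq _ _).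
by rewrite !(scaleqE, addqE) scalerDr.
Qed.

Lemma scaleqDl c : {morph scaleq^~ c : a b / a + b}.
Proof.
move=> a b; elim/quotvI: c => x; rewrite -[RHS]/(addq _ _).
by rewrite !(scaleqE, addqE) scalerDl.
Qed.

HB.instance Definition _ := GRing.Zmodule_isLmodule.Build K quotv
  scaleqA scale1q scaleqDr scaleqDl.

Lemma pi_is_linear : linear cls.
Proof.
move=> a x y; rewrite -[RHS]/(addq (scaleq a (cls x)) (cls y)).
by rewrite !(scaleqE, addqE).
Qed.

HB.instance Definition _ := GRing.isLinear.Build K E quotv *:%R cls pi_is_linear.

Lemma quotv_vect_axiom : Vector.axiom (dim (subvs_of W^C)) quotv.
Proof.
have cap0 : (W^C :&: W = 0)%VS by rewrite capvC capv_compl.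
pose p : 'End(E) := daddv_pi W^C W.
have pW w : w \in W -> p w = 0.
  move=> wW; have wT : (w \in W^C + W)%VS by rewrite addvC addv_complf memvf.
  have := daddv_pi_add cap0 wT.
  rewrite (@daddv_pi_id _ _ W) ?capv_compl // => /eqP.
  by rewrite -subr_eq0 addrK => /eqP.
have pE x : p (repr (cls x)) = p x.
  by apply/eqP; rewrite -subr_eq0 -linearB; apply/eqP/pW/repr_sim.
pose f (c : quotv) := v2r (vsproj W^C (p (repr c))).
exists f.
  move=> a; elim/quotvI => x; elim/quotvI => y.
  by rewrite -linearP /f !pE !linearP.
exists (fun u => cls (vsval (r2v u : subvs_of W^C))) => [|u]; last first.
  by rewrite /f pE daddv_pi_id ?subvsP // vsvalK r2vK.
elim/quotvI => x; rewrite /f v2rK pE vsprojK ?memv_pi //; apply/quotvP.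
have xT : (x \in W^C + W)%VS by rewrite addvC addv_complf memvf.
rewrite -[X in _ - X](daddv_pi_add cap0 xT) opprD addrA subrr add0r memvN.
exact: memv_pi.
Qed.

HB.instance Definition _ := Lmodule_hasFinDim.Build K quotv quotv_vect_axiom.

Definition class x : quotv := cls x.

Definition coset (c : quotv) : set E := [set x | class x = c].

Lemma cosetE x y : coset (class x) y <-> sim y x.
Proof. by split => [/quotvP|h]; last exact/quotvP. Qed.

End Quotient.

Section LinearGeometry.
Variables (K : fieldType) (E : vectType K).
Implicit Types (X Y : set E) (U : {vspace E}).

Definition is_linear_span X U :=
  (forall x, X x -> x \in U) /\
  (forall U', (forall x, X x -> x \in U') -> (U <= U')%VS).

Definition linear_span X : {vspace E} := xget fullv [set U | is_linear_span X U].

Lemma linear_spanP X : is_linear_span X (linear_span X).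
Proof.
apply: (@xgetPex _ fullv [set U | is_linear_span X U]).
pose P k := `[< exists2 U : {vspace E}, \dim U = k & forall x, X x -> x \in U >].
have exP : exists k, P k.
  by exists (\dim {:E}); apply/asboolP; exists fullv => // x _; exact: memvf.
case: (ex_minnP exP) => k /asboolP[U dU XU] kmin; exists U; split => // U' XU'.
have : (k <= \dim (U :&: U'))%N.
  apply: kmin; apply/asboolP; exists (U :&: U')%VS => // x Xx.
  by rewrite memv_cap XU ?XU'.
rewrite -dU => le; have /eqP <- : (U :&: U' == U)%VS by rewrite eqEdim capvSl.
exact: capvSr.
Qed.

(* dimension of the affine hull, for nonempty X *)
Definition affdim X : nat := \dim (linear_span [set x - y | x in X & y in X]).

Definition affine_subspace X (k : nat) :=
  exists x0 U, \dim U = k /\ X = [set x0 + u | u in [set u | u \in U]].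

Definition parallel X Y := exists v, Y = [set x + v | x in X].

End LinearGeometry.

Section Euclidean.
Variable R : realType.

Definition dot n (u v : 'cV[R]_n) : R := \sum_i u i 0 * v i 0.

Lemma dot_is_linear n (u : 'cV[R]_n) : linear (dot u : 'cV[R]_n -> R^o).
Proof.
move=> a x y; rewrite /dot scaler_sumr -big_split /=; apply: eq_bigr => i _.
by rewrite !mxE mulrDr mulrCA.
Qed.

HB.instance Definition _ n (u : 'cV[R]_n) :=
  GRing.isLinear.Build R 'cV[R]_n R^o *:%R (dot u) (dot_is_linear u).

Lemma dotC n (u v : 'cV[R]_n) : dot u v = dot v u.
Proof. by apply: eq_bigr => i _; rewrite mulrC. Qed.

Definition orthogonal_compl n (U : {vspace 'cV[R]_n}) : {vspace 'cV[R]_n} :=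
  (\bigcap_(i < \dim U) lker (linfun (dot ((vbasis U)`_i) : _ -> R^o)))%VS.

Lemma orthogonal_complP n (U : {vspace 'cV[R]_n}) (v : 'cV[R]_n) :
  reflect (forall u, u \in U -> dot u v = 0) (v \in orthogonal_compl U).
Proof.
apply: (iffP idP) => [/subv_bigcapP h u uU | h].
  rewrite dotC (coord_vbasis uU) linear_sum big1 // => i _.
  have := h i isT; rewrite -memvE memv_ker lfunE /= => /eqP ui.
  by rewrite linearZ /= dotC ui scaler0.
apply/subv_bigcapP => i _; rewrite -memvE memv_ker lfunE /= h //.
by apply: vbasis_mem; rewrite mem_nth ?size_tuple.
Qed.

Definition ominus n (U U' : {vspace 'cV[R]_n}) := (U :&: orthogonal_compl U')%VS.

Definition conv n (X : set 'cV[R]_n) : set 'cV[R]_n :=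
  [set x | exists k (w : 'I_k -> R) (p : 'I_k -> 'cV[R]_n),
     [/\ forall j, 0 <= w j, \sum_j w j = 1, forall j, X (p j)
       & x = \sum_j w j *: p j]].

(* nonempty faces, C itself included (c = 0) *)
Definition face n (C G : set 'cV[R]_n) :=
  G !=set0 /\
  exists c, G = [set t | C t /\ forall u, C u -> dot c u <= dot c t].

Definition unique_face n (C : set 'cV[R]_n) (k : nat) (X G : set 'cV[R]_n) :=
  [/\ face C G, affdim G = k, X `<=` G
    & forall G', face C G' -> affdim G' = k -> X `<=` G' -> G' = G].

Definition normal_cone n (C G : set 'cV[R]_n) : set 'cV[R]_n :=
  [set c | forall t, G t -> forall u, C u -> dot c u <= dot c t].

Definition colspan n k (A : 'M[R]_(n, k)) : {vspace 'cV[R]_n} :=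
  <<[tuple col j A | j < k]>>%VS.

Definition columns_basis n k (A : 'M[R]_(n, k)) (U : {vspace 'cV[R]_n}) :=
  basis_of U [tuple col j A | j < k].

Definition mxfun n k (A : 'M[R]_(n, k)) : 'Hom('cV[R]_k, 'cV[R]_n) :=
  linfun (mulmx A).

(* R^J is represented as column vectors of size #|J| *)
Definition coordproj n (J : {set 'I_n}) : 'Hom('cV[R]_n, 'cV[R]_#|J|) :=
  linfun (rowsub (fun k : 'I_#|J| => enum_val k)).

End Euclidean.

Definition borel (R : realType) k :=
  g_sigma_algebraType (@open 'cV[R]_k).

Section ExponentialFamilies.
Local Open Scope ereal_scope.

Definition same_distr d (T : measurableType d) (R : realType)
    (P Q : set T -> \bar R) :=
  forall B, measurable B -> P B = Q B.

Definition log_partition (R : realType) k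
    (mu : set (borel R k) -> \bar R) (theta : 'cV[R]_k) : R :=
  ln (fine (\int[mu]_t (expR (dot t theta))%:E)).

Definition expfam (R : realType) k
    (mu : set (borel R k) -> \bar R) (theta : 'cV[R]_k) :
    set (borel R k) -> \bar R :=
  fun B => \int[mu]_(t in B) (expR (dot t theta - log_partition mu theta))%:E.

(* an exponential family representation of (P theta)_theta by a k-dimensional
   statistic tau; the carrier density is absorbed in the measure lam *)
Definition expfam_representation d (T : measurableType d) (R : realType)
    (I : Type) (P : I -> set T -> \bar R) (k : nat) :=
  exists (lam : {sigma_finite_measure set T -> \bar R}) (tau : T -> borel R k)
         (eta : I -> 'cV[R]_k) (phi : I -> R),
    measurable_fun setT tau /\
    forall theta, same_distr (P theta) (fun B =>
      \int[lam]_(t in B) (expR (dot (tau t) (eta theta) - phi theta))%:E).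

Definition has_order d (T : measurableType d) (R : realType)
    (I : Type) (P : I -> set T -> \bar R) (k : nat) :=
  expfam_representation P k /\
  forall k', expfam_representation P k' -> (k <= k')%N.

End ExponentialFamilies.

(* the countable set N^n, every subset being measurable *)
Definition counts n := g_sigma_algebraType [set: set 'cV[nat]_n].

Section LogLinear.
Variables (R : realType) (n : nat).

Definition realcounts (x : counts n) : 'cV[R]_n := map_mx (fun k => k%:R) x.

Definition sampling_set m (V : 'M[R]_(n, m)) : set (counts n) :=
  [set x | V^T *m realcounts x = const_mx 1].

Definition poisson_weight (x : counts n) : R :=
  \prod_(i < n) ((x i 0)`!%:R)^-1.

Definition nu m (V : 'M[R]_(n, m)) (B : set (counts n)) : \bar R :=
  \esum_(x in B `&` sampling_set V) (poisson_weight x)%:E.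

Section NuMeasure.
Variables (m : nat) (V : 'M[R]_(n, m)).
Local Open Scope ereal_scope.

Let weight_ge0 x : 0 <= (poisson_weight x)%:E.
Proof. by rewrite lee_fin; apply: prodr_ge0 => i _; rewrite invr_ge0. Qed.

Let nu0 : nu V set0 = 0. Proof. by rewrite /nu set0I esum_set0. Qed.

Let nu_ge0 B : 0 <= nu V B. Proof. by apply: esum_ge0. Qed.

Let nu_sigma_additive : semi_sigma_additive (nu V).
Proof.
move=> F _ tF _; rewrite [X in _ --> X](_ : _ = \sum_(0 <= i <oo) nu V (F i)).
  by apply: is_cvg_nneseries => i _ _; exact: nu_ge0.
rewrite /nu setI_bigcupl nneseries_sum_bigcup //.
apply/trivIsetP => i j _ _ ij; move/trivIsetP : tF => /(_ i j I I ij).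
by rewrite setIACA => ->; rewrite set0I.
Qed.

HB.instance Definition _ :=
  isMeasure.Build _ _ _ (nu V) nu0 nu_ge0 nu_sigma_additive.

End NuMeasure.

Definition A0 m (V : 'M[R]_(n, m)) := sampling_set V !=set0.

Definition A1 m (N : {vspace 'cV[R]_n}) (V : 'M[R]_(n, m)) :=
  ~ exists gamma, [/\ gamma \in orthogonal_compl N, gamma != 0
    & exists c, {ae nu V, forall x, dot gamma (realcounts x) = c}].

Definition A2 m (V : 'M[R]_(n, m)) :=
  [set x : 'cV[R]_n | (forall i, 0 <= x i 0) /\ V^T *m x = const_mx 1] =
  conv [set realcounts x | x in sampling_set V].

Variables (d : nat) (A : 'M[R]_(n, d)).

Definition suffstat (x : counts n) : borel R d := A^T *m realcounts x.

Definition mu m (V : 'M[R]_(n, m)) : set (borel R d) -> \bar R :=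
  pushforward (nu V) suffstat.

Definition convex_support m (V : 'M[R]_(n, m)) : set 'cV[R]_d :=
  closure (conv [set A^T *m realcounts x | x in sampling_set V]).

Definition marginal_cone : set 'cV[R]_d :=
  [set t | exists w : 'I_n -> R,
    (forall i, 0 <= w i) /\ t = \sum_i w i *: (row i A)^T].

Definition facial_set (F : set 'cV[R]_d) : {set 'I_n} :=
  [set i | `[< F (row i A)^T >]]%SET.

Definition normal_span (F : set 'cV[R]_d) : {vspace 'cV[R]_d} :=
  linear_span (normal_cone marginal_cone F).

(* Z + L_F, where Z = {zeta | A zeta in N} *)
Definition nonident (N : {vspace 'cV[R]_n}) (F : set 'cV[R]_d) :
    {vspace 'cV[R]_d} :=
  (mxfun A @^-1: N + normal_span F)%VS.

Definition Theta N F := quotv (nonident N F).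

(* N_F = A (Z + L_F), which contains N.  For a proper face F it is M (-) N_F,
   and not M (-) N, whose projection on the facial set has the dimension of the
   face: for A = 1%:M of size 3, N spanned by const_mx 1 and F a ray, the
   former projection is 0 and the latter is a line. *)
Definition facial_subspace (N : {vspace 'cV[R]_n}) (F : set 'cV[R]_d) :
    {vspace 'cV[R]_n} :=
  (mxfun A @: nonident N F)%VS.

(* fun B => mu V (B `&` FV) is mrestr (mu V) for the closed set FV *)
Definition extended_family m (V : 'M[R]_(n, m)) (FV : set 'cV[R]_d) :
    'cV[R]_d -> set (borel R d) -> \bar R :=
  expfam (fun B => mu V (B `&` FV)).

End LogLinear.

(* Main.v *)
Require Import Defs.
From HB Require Import structures.
From mathcomp Require Import all_boot all_order all_algebra.
From mathcomp Require Import all_classical all_reals all_analysis.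
From mathcomp Require Import measurable_realfun.
From mathcomp Require Import zify lra.

(** Write a_i for the rows of A, Z for the space of all zeta with A zeta in N,
    and D for the span of the differences of points of F_V, so that D has
    dimension d_F.  All the assertions follow from one identity,
    W = Z + L_F = D^perp, where the sum is direct ([nonident_direction],
    [sampling_cap_vanishing]): two parameters give proportional densities on
    F_V exactly when their difference is constant on F_V, that is, lies in
    D^perp.

    Geometry.  A face of the marginal cone is cut out by a functional that
    vanishes on the a_i of its facial set and is negative on the other ones.
    Adding a small multiple of any v that vanishes on the facial set does not
    spoil these signs, hence L_F consists of all such v
    ([normal_span_subcone]) and has dimension d - m - d_F.  A functional in Z
    is constant on the convex support and one in L_F vanishes on F, so
    Z + L_F is contained in D^perp, and a comparison of dimensions leaves only
    the triviality of the intersection of Z and L_F.  Choose a nonnegative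
    table x over F_V whose support J0 is maximal.  Motzkin's transposition
    theorem shows that J0 is a facial set ([support_facial]), and moving x along
    directions supported by J0 shows that D^perp lies in the sum of Z and the
    functionals vanishing on J0 ([orthogonal_direction_interior]).  If J0 is
    the facial set of F, counting dimensions finishes the argument.  If F is the
    whole cone, L_F is zero because A has full rank.  Otherwise the face of J0
    is strictly smaller than F and F is proper, so the diamond property of face
    lattices ([facial_diamond]) yields a second face with the dimension of F that
    contains F_V, against the uniqueness of F.

    Statistics.  The log-partition function is finite because the sum over all
    tables of prod_i y_i^x_i / x_i! is at most prod_i exp y_i
    ([poisson_sum_le]).  Being a face, F_V is the convex hull of the sufficient
    statistics of observable tables that it contains; these atoms have positive
    mass and the same direction space D ([direction_face_atom]).  Comparing
    densities at the atoms identifies the parameter modulo D^perp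
    ([extended_family_inj]), while parameters that agree modulo D^perp have the
    same normalized density ([extended_family_eq]).

    Order.  Inner products with a basis of D give a representation of
    dimension d_F.  Conversely, for a representation with statistic tau in R^k,
    the log-densities at two atoms give
    (t - t', theta) = (tau t - tau t', eta theta - eta 0), so a matrix whose
    rows form a basis of D factors through R^k ([pairing_dim]).

    Parametrization.  The kernel of pi_F A is L_F, so the class of theta is a
    function of pi_F (A theta).  Every class meets each set of parameters with
    A theta orthogonal to A W or to N.  On the former the class determines
    A theta; on the latter it determines pi_F (A theta) precisely when A L_F is
    orthogonal to N ([injective_sampling]). *)

Set Implicit Arguments.
Unset Strict Implicit.
Unset Printing Implicit Defensive.

Import Order.TTheory GRing.Theory Num.Theory.
Import numFieldNormedType.Exports.

Local Open Scope classical_set_scope.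
Local Open Scope ring_scope.

(** * Orthogonal complements *)

Section Orthogonality.
Variable R : realType.

Lemma dotDl n (u v w : 'cV[R]_n) : dot (u + v) w = dot u w + dot v w.
Proof. by rewrite !(dotC _ w) linearD. Qed.

Lemma dotBl n (u v w : 'cV[R]_n) : dot (u - v) w = dot u w - dot v w.
Proof. by rewrite !(dotC _ w) linearB. Qed.

Lemma dotBr n (u v w : 'cV[R]_n) : dot w (u - v) = dot w u - dot w v.
Proof. by rewrite linearB. Qed.

Lemma dotDr n (u v w : 'cV[R]_n) : dot w (u + v) = dot w u + dot w v.
Proof. by rewrite linearD. Qed.

Lemma dotZr n a (u v : 'cV[R]_n) : dot u (a *: v) = a * dot u v.
Proof. by rewrite linearZ. Qed.

Lemma dotZl n a (u v : 'cV[R]_n) : dot (a *: u) v = a * dot u v.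
Proof. by rewrite dotC dotZr dotC. Qed.

Lemma dot0r n (u : 'cV[R]_n) : dot u 0 = 0.
Proof. by rewrite linear0. Qed.

Lemma dot0l n (u : 'cV[R]_n) : dot 0 u = 0.
Proof. by rewrite dotC dot0r. Qed.

Lemma dot_sumr n (I : finType) (P : pred I) (F : I -> 'cV[R]_n) u :
  dot u (\sum_(i | P i) F i) = \sum_(i | P i) dot u (F i).
Proof. by rewrite linear_sum. Qed.

Lemma dot_trmx p q (B : 'M[R]_(p, q)) v h :
  dot v (B^T *m h) = dot (B *m v) h.
Proof.
rewrite /dot; under eq_bigr do rewrite mxE big_distrr /=.
rewrite exchange_big /=; apply: eq_bigr => i _.
by rewrite mxE big_distrl /=; apply: eq_bigr => j _; rewrite mxE mulrA (mulrC (v j 0)).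
Qed.

Lemma dot_delta n (u : 'cV[R]_n) i : dot u (delta_mx i 0) = u i 0.
Proof.
rewrite /dot (bigD1 i) //= mxE !eqxx mulr1 big1 ?addr0 // => j /negbTE ji.
by rewrite mxE ji mulr0.
Qed.

Lemma dot_self_eq0 n (u : 'cV[R]_n) : dot u u = 0 -> u = 0.
Proof.
move=> /psumr_eq0P u0; apply/matrixP => i j; rewrite !ord1 mxE; apply/eqP.
have := u0 (fun i _ => sqr_ge0 (u i 0)) i isT.
by move/eqP; rewrite mulf_eq0 orbb.
Qed.

(** The inner product is definite. *)
Lemma orthogonal_compl_cap n (U : {vspace 'cV[R]_n}) :
  (U :&: orthogonal_compl U = 0)%VS.
Proof.
apply/eqP; rewrite -subv0; apply/subvP => u; rewrite memv_cap memv0.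
by case/andP => uU /orthogonal_complP /(_ u uU) /dot_self_eq0 ->.
Qed.

Lemma dim_cV n : \dim (fullv : {vspace 'cV[R]_n}) = n.
Proof. by rewrite dimvf dim_matrix mulr1. Qed.

(** The complement is the kernel of the coordinates against a basis of [U], which
    bounds its dimension below; its disjointness from [U] bounds it above. *)
Lemma dim_orthogonal_compl n (U : {vspace 'cV[R]_n}) :
  (\dim U + \dim (orthogonal_compl U))%N = n.
Proof.
have disj := orthogonal_compl_cap U.
apply/eqP; rewrite eqn_leq -dimv_disjoint_sum //.
rewrite -[X in (_ <= X)%N]dim_cV dimvS ?subvf //=.
pose f : 'Hom('cV[R]_n, 'cV[R]_(\dim U)) :=
  mxfun (\matrix_(i < \dim U, j < n) (vbasis U)`_i j 0).
have fE v i : f v i 0 = dot (vbasis U)`_i v.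
  by rewrite /f /mxfun lfunE /= mxE; apply: eq_bigr => j _; rewrite mxE.
have kerf : (lker f <= orthogonal_compl U)%VS.
  apply/subvP => v; rewrite memv_ker => /eqP fv0; apply/orthogonal_complP => u uU.
  rewrite dotC (coord_vbasis uU) dot_sumr big1 // => i _.
  by rewrite dotZr dotC -fE fv0 mxE mulr0.
rewrite dimv_disjoint_sum // -[X in (X <= _)%N]dim_cV -(limg_ker_dim f fullv) capfv addnC.
by rewrite leq_add ?dimvS // -[X in (_ <= X)%N]dim_cV dimvS ?subvf.
Qed.

Lemma orthogonal_compl_sum n (U : {vspace 'cV[R]_n}) :
  (U + orthogonal_compl U = fullv)%VS.
Proof.
apply/eqP; rewrite eqEdim subvf dimv_disjoint_sum ?orthogonal_compl_cap //=.
by rewrite dim_orthogonal_compl dim_cV leqnn.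
Qed.

Lemma orthogonal_complK n (U : {vspace 'cV[R]_n}) :
  orthogonal_compl (orthogonal_compl U) = U.
Proof.
apply/esym/eqP; rewrite eqEdim; apply/andP; split.
  apply/subvP => u uU; apply/orthogonal_complP => v /orthogonal_complP/(_ u uU).
  by rewrite dotC.
have dU := dim_orthogonal_compl U; have := dim_orthogonal_compl (orthogonal_compl U).
by rewrite -[X in _ = X -> _]dU addnC => /addIn ->.
Qed.

Lemma orthogonal_complS n (U U' : {vspace 'cV[R]_n}) :
  (U <= U')%VS -> (orthogonal_compl U' <= orthogonal_compl U)%VS.
Proof.
move=> /subvP UU'; apply/subvP => v /orthogonal_complP vU'.
by apply/orthogonal_complP => u /UU'; exact: vU'.
Qed.

Lemma orthogonal_compl_add n (U U' : {vspace 'cV[R]_n}) :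
  orthogonal_compl (U + U') = (orthogonal_compl U :&: orthogonal_compl U')%VS.
Proof.
apply/vspaceP => v; rewrite memv_cap; apply/orthogonal_complP/andP => [vUU'|].
  by split; apply/orthogonal_complP => u uU; apply: vUU';
    [rewrite -[u]addr0 | rewrite -[u]add0r]; rewrite memv_add ?mem0v.
move=> [/orthogonal_complP vU /orthogonal_complP vU'] _ /memv_addP[u uU [u' u'U' ->]].
by rewrite dotDl vU ?vU' ?addr0.
Qed.

Lemma orthogonal_compl_capE n (U U' : {vspace 'cV[R]_n}) :
  orthogonal_compl (U :&: U') = (orthogonal_compl U + orthogonal_compl U')%VS.
Proof. by rewrite -[RHS]orthogonal_complK orthogonal_compl_add !orthogonal_complK. Qed.

(** Subspaces given as spans of arbitrary sets are only handled through their
    annihilators, for which it is enough to test the generators. *)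
Lemma orthogonal_compl_linear_span n (X : set 'cV[R]_n) v :
  v \in orthogonal_compl (linear_span X) <-> forall x, X x -> dot x v = 0.
Proof.
have [Xspan spanX] := linear_spanP X; split => [/orthogonal_complP vX x Xx|vX].
  exact/vX/Xspan.
apply/orthogonal_complP => x xX.
have /subvP/(_ _ xX)/orthogonal_complP : (linear_span X <= orthogonal_compl <[v]>)%VS.
  by apply: spanX => y Xy; apply/orthogonal_complP => _ /vlineP[a ->]; rewrite dotZl dotC vX ?mulr0.
by move=> /(_ v (memv_line v)); rewrite dotC.
Qed.

(** Fundamental theorem of linear algebra: the row space is the annihilator of
    the kernel. *)
Lemma limg_trmx p q (B : 'M[R]_(p, q)) :
  orthogonal_compl (lker (mxfun B)) = limg (mxfun B^T).
Proof.
rewrite -[RHS]orthogonal_complK; congr orthogonal_compl; apply/vspaceP => v.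
apply/idP/orthogonal_complP => [|vB].
  rewrite memv_ker lfunE /= => /eqP Bv _ /memv_imgP[h _ ->].
  by rewrite lfunE /= dotC dot_trmx Bv dot0l.
rewrite memv_ker lfunE /=; apply/eqP/dot_self_eq0; rewrite -dot_trmx dotC.
by apply: vB; rewrite -[_ *m _](lfunE (mulmx B^T)) memv_img ?memvf.
Qed.

End Orthogonality.

(** * Facial sets and the diamond property *)

(** The step must lie below every ratio [f i / `|g i|]; the inverse of
    [1 + \sum_i `|g i| / f i] does. *)
Lemma small_perturbation (R : realType) (I : finType) (P : pred I) (f g : I -> R) :
  (forall i, P i -> 0 < f i) ->
  exists2 e, 0 < e & forall i, P i -> `|e * g i| < f i.
Proof.
move=> f_gt0; pose s := \sum_(i | P i) `|g i| / f i.
have s_ge0 : 0 <= s by apply: sumr_ge0 => i Pi; rewrite divr_ge0 // ltW ?f_gt0.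
have s1_gt0 : 0 < 1 + s by rewrite ltr_wpDr.
exists (1 + s)^-1 => [|i Pi]; first by rewrite invr_gt0.
rewrite normrM gtr0_norm ?invr_gt0 // mulrC ltr_pdivrMr // -ltr_pdivrMl ?f_gt0 // mulrC.
rewrite (@le_lt_trans _ _ s) ?ltrDr // /s (bigD1 i) //= lerDl sumr_ge0 // => j /andP[Pj _].
by rewrite divr_ge0 // ltW ?f_gt0.
Qed.

Section Facial.
Variables (R : realType) (n d : nat) (A : 'M[R]_(n, d)).
Implicit Types (J G H K F : {set 'I_n}) (c v : 'cV[R]_d).

(** The annihilator of the rows indexed by [J]; when [J] is a facial set, it is the
    span of the normal cone of the corresponding face. *)
Definition vanishing J : {vspace 'cV[R]_d} := lker (coordproj R J \o mxfun A)%VF.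

Lemma vanishingP J v : reflect {in J, forall i, (A *m v) i 0 = 0} (v \in vanishing J).
Proof.
rewrite memv_ker comp_lfunE [coordproj _ _ _]lfunE /= [mxfun A v]lfunE /=.
apply: (iffP eqP) => [/matrixP Av i iJ|Av].
  by have := Av (enum_rank_in iJ i) 0; rewrite !mxE enum_rankK_in.
apply/matrixP => k j; rewrite !ord1; have := Av _ (enum_valP k).
by rewrite !mxE.
Qed.

Lemma vanishingS J K : J \subset K -> (vanishing K <= vanishing J)%VS.
Proof.
move=> /fintype.subsetP JK; apply/subvP => v /vanishingP vK.
by apply/vanishingP => i /JK; exact: vK.
Qed.

Lemma vanishingU1 i J :
  vanishing (i |: J) = (vanishing J :&: orthogonal_compl <[(A^T *m delta_mx i 0)%R]>)%VS.
Proof.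
have iE v : dot (A^T *m delta_mx i 0) v = (A *m v) i 0.
  by rewrite dotC dot_trmx dot_delta.
apply/vspaceP => v; rewrite memv_cap; apply/vanishingP/andP => [vJ|[/vanishingP vJ]].
  split; first by apply/vanishingP => j jJ; rewrite vJ // inE jJ orbT.
  by apply/orthogonal_complP => _ /vlineP[a ->]; rewrite dotZl iE vJ ?mulr0 ?setU11.
move=> /orthogonal_complP vi j; rewrite !inE => /orP[/eqP ->|]; last exact: vJ.
by rewrite -iE vi ?memv_line.
Qed.

Lemma dim_vanishingU1 i J : (\dim (vanishing J) <= (\dim (vanishing (i |: J))).+1)%N.
Proof.
rewrite vanishingU1; set a := <[_]>%VS.
have := dimv_sum_cap (vanishing J) (orthogonal_compl a).
have := dim_orthogonal_compl a; have : (\dim a <= 1)%N by rewrite dim_vline leq_b1.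
have : (\dim (vanishing J + orthogonal_compl a) <= d)%N.
  by rewrite -[X in (_ <= X)%N](dim_cV R) dimvS ?subvf.
by rewrite /reverse_coercion; lia.
Qed.

(** The annihilator of [vanishing J] is spanned by the rows in [J]; the
    coefficients are stored in a vector supported by [J]. *)
Lemma orthogonal_vanishing J u : u \in orthogonal_compl (vanishing J) ->
  exists2 h : 'cV[R]_n, (forall i, i \notin J -> h i 0 = 0) & u = A^T *m h.
Proof.
pose B := \matrix_(i, j) (A i j *+ (i \in J)).
have BE k (C : 'M[R]_(d, k)) i j : (B *m C) i j = (A *m C) i j *+ (i \in J).
  by rewrite !mxE -sumrMnl; apply: eq_bigr => l _; rewrite mxE mulrnAl.
have -> : vanishing J = lker (mxfun B).
  apply/vspaceP => v; rewrite [RHS]memv_ker lfunE /=; apply/vanishingP/eqP => [vJ|Bv i iJ].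
    by apply/matrixP => i j; rewrite !ord1 BE; have [/vJ ->|_] := boolP (i \in J); rewrite ?mxE.
  by have := BE _ v i 0; rewrite Bv iJ mxE.
rewrite limg_trmx => /memv_imgP[h _ ->]; exists (\col_i (h i 0 *+ (i \in J))) => [i iJ|].
  by rewrite mxE (negbTE iJ).
rewrite lfunE /=; apply/matrixP => j k; rewrite !ord1 !mxE; apply: eq_bigr => i _.
by rewrite !mxE mulrnAl mulrnAr.
Qed.

(** The sets of rows lying on a common face of the marginal cone, recorded by a
    functional that exposes the face. *)
Definition facial J := exists2 c : 'cV[R]_d,
  forall i, (A *m c) i 0 <= 0 & forall i, (i \in J) = ((A *m c) i 0 == 0).

Lemma facial_setT : facial [set: 'I_n]%SET.
Proof. by exists 0 => i; rewrite mulmx0 mxE ?lexx // inE eqxx. Qed.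

Lemma facial_dim_lt G H : facial G -> G \proper H ->
  (\dim (vanishing H) < \dim (vanishing G))%N.
Proof.
move=> [c _ cG] /fintype.properP[GH [i iH]]; rewrite cG => ci.
rewrite ltn_neqAle dimvS ?vanishingS // andbT; apply: contra ci => dimE.
have /eqP HG : vanishing H == vanishing G by rewrite eqEdim vanishingS //= (eqP dimE).
have : c \in vanishing G by apply/vanishingP => j; rewrite cG => /eqP.
by rewrite -HG => /vanishingP ->.
Qed.

Lemma mulmxDZ_entry c e v i :
  (A *m (c + e *: v)) i 0 = (A *m c) i 0 + e * (A *m v) i 0.
Proof. by rewrite mulmxDr -scalemxAr mxE [X in _ + X]mxE. Qed.

(** Starting from the functional of [G], move in the direction [v] until it first
    vanishes at a new row of [H].  The row [i0], where [v] is zero, is left out,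
    which keeps the new set away from [H].  Adding a small multiple of the result
    to the functional of [H] controls the rows outside [H]. *)
Lemma facial_between G H i0 v : facial G -> facial H -> G \proper H ->
  i0 \in H -> i0 \notin G -> {in G, forall i, (A *m v) i 0 = 0} ->
  (A *m v) i0 0 = 0 -> (exists2 j, j \in H & 0 < (A *m v) j 0) ->
  exists K, [/\ facial K, G \proper K, K \proper H & i0 \notin K].
Proof.
move=> [cG cG_le0 GE] [cH cH_le0 HE] GH i0H i0G vG vi0 [j0 j0H vj0].
pose P i := (i \in H) && (0 < (A *m v) i 0).
have Pj0 : P j0 by rewrite /P j0H vj0.
pose r i := - (A *m cG) i 0 / (A *m v) i 0.
case: (@arg_minP _ _ _ j0 P r Pj0) => jm /andP[jmH vjm] jm_min.
(* the first time at which the moving functional vanishes at a new row of H *)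
pose s := r jm; pose w := cG + s *: v.
have wE i : (A *m w) i 0 = (A *m cG) i 0 + s * (A *m v) i 0.
  exact: mulmxDZ_entry.
have s_ge0 : 0 <= s by rewrite /s /r divr_ge0 ?oppr_ge0 ?cG_le0 ?ltW.
have w_le0 i : i \in H -> (A *m w) i 0 <= 0.
  move=> iH; rewrite wE; case: (lerP ((A *m v) i 0) 0) => vi.
    by have := cG_le0 i; nra.
  have : s <= r i by apply: jm_min; rewrite /P iH vi.
  by rewrite /r ler_pdivlMr //; lra.
have wjm : (A *m w) jm 0 = 0 by rewrite wE /s /r divfK ?gt_eqF // subrr.
have [|e e_gt0 small] := @small_perturbation R _ [pred i | i \notin H]
    (fun i => - (A *m cH) i 0) (fun i => (A *m w) i 0).
  by move=> i /=; rewrite HE oppr_gt0 lt_neqAle cH_le0 andbT.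
pose c := cH + e *: w.
have cE i : (A *m c) i 0 = (A *m cH) i 0 + e * (A *m w) i 0.
  exact: mulmxDZ_entry.
have cH0 i : i \in H -> (A *m c) i 0 = e * (A *m w) i 0.
  by move=> iH; move: (iH); rewrite cE HE => /eqP ->; rewrite add0r.
have c_lt0 i : i \notin H -> (A *m c) i 0 < 0.
  by move=> /small; rewrite cE ltr_norml => /andP[_]; lra.
exists [set i | (A *m c) i 0 == 0]%SET.
have KE i : (i \in [set i | (A *m c) i 0 == 0]%SET) = (i \in H) && ((A *m w) i 0 == 0).
  rewrite inE; case: (boolP (i \in H)) => [iH|/c_lt0/lt_eqF //].
  by rewrite cH0 // mulf_eq0 gt_eqF.
have wi0 : (A *m w) i0 0 != 0 by rewrite wE vi0 mulr0 addr0 -GE.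
split.
- exists c => i; last by rewrite inE.
  by case: (boolP (i \in H)) => [iH|/c_lt0/ltW //]; rewrite cH0 // pmulr_rle0 // w_le0.
- apply/fintype.properP; split; last first.
    exists jm; first by rewrite KE jmH wjm eqxx.
    by apply: contraL vjm => /vG ->; rewrite ltxx.
  apply/fintype.subsetP => i iG; rewrite KE (fintype.subsetP (proper_sub GH)) //= wE vG // mulr0 addr0.
  by rewrite -GE.
- apply/fintype.properP; split; first by apply/fintype.subsetP => i; rewrite KE => /andP[].
  by exists i0; rewrite // KE negb_and wi0 orbT.
- by rewrite KE negb_and wi0 orbT.
Qed.

Lemma mulmxN_entry v i : (A *m - v) i 0 = - (A *m v) i 0.
Proof. by rewrite mulmxN [LHS]mxE. Qed.

(** When the codimensions differ by more than one, some [v] vanishes on [G] and at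
    one further row [i0] of [H] without vanishing on all of [H]. *)
Lemma facial_chain G H : facial G -> facial H -> G \proper H ->
  ((\dim (vanishing H)).+1 < \dim (vanishing G))%N ->
  exists K, [/\ facial K, G \proper K & K \proper H].
Proof.
move=> fG fH GH dimGH; have /fintype.properP[_ [i0 i0H i0G]] := GH.
have /subvPn[v v0 vH] : ~~ (vanishing (i0 |: G) <= vanishing H)%VS.
  apply/negP => /dimvS le; have := leq_trans dimGH (dim_vanishingU1 i0 G).
  by rewrite ltnS ltnNge le.
move/vanishingP in v0.
have [j jH vj] : exists2 j, j \in H & (A *m v) j 0 != 0.
  move/negP: vH => vH; apply: contrapT => nj; apply/vH/vanishingP => i iH.
  by apply/eqP; apply: contrapT => /negP vi; apply: nj; exists i.
(* the sign of v is free *)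
wlog vj_gt0 : v v0 vj {vH} / 0 < (A *m v) j 0 => [wl|].
  have [vj_lt0|vj_gt0|v_eq0] := ltgtP ((A *m v) j 0) 0; last by rewrite v_eq0 eqxx in vj.
    by apply: (wl (- v)); rewrite ?mulmxN_entry ?oppr_eq0 ?oppr_gt0 // => i iG; rewrite mulmxN_entry v0 ?oppr0.
  exact: (wl v).
have [|||K [fK GK KH _]] := facial_between fG fH GH i0H i0G (v := v); last by exists K.
- by move=> i iG; rewrite v0 // inE iG orbT.
- by rewrite v0 ?setU11.
- by exists j.
Qed.

(** Shrink [G] to a maximal facial set [L] below [F] and choose a minimal [H] above
    [F]; consecutive dimensions differ by one.  Rotating the functional of [L] away
    from that of [F] produces a facial set between [L] and [H] that avoids a row of
    [F], so its dimension is the one in between. *)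
Lemma facial_diamond G F : facial G -> facial F -> G \proper F -> F != [set: 'I_n]%SET ->
  exists F', [/\ facial F', G \subset F', F' != F &
    \dim (vanishing F') = \dim (vanishing F)].
Proof.
move=> fG fF GF FT.
pose P K := [&& `[< facial K >], G \subset K & K \proper F].
have PG : P G by rewrite /P GF fintype.subxx !andbT; exact/asboolP.
case: (@arg_maxnP _ G P (fun K => #|K|) PG) => L /and3P[/asboolP fL GL LF] Lmax.
pose Q K := `[< facial K >] && (F \proper K).
have QT : Q [set: 'I_n]%SET by rewrite /Q properT FT andbT; apply/asboolP/facial_setT.
case: (@arg_minnP _ [set: 'I_n]%SET Q (fun K => #|K|) QT) => H /andP[/asboolP fH FH] Hmin.
have [i0 i0F i0L] : exists2 i, i \in F & i \notin L by case/fintype.properP: LF.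
have [j jH jF] : exists2 i, i \in H & i \notin F by case/fintype.properP: FH.
have [cF cF_le0 FE] := fF.
have LH : L \proper H := proper_trans LF FH.
have [|||||K [fK LK KH i0K]] := @facial_between L H i0 (- cF) fL fH LH.
- exact: (fintype.subsetP (proper_sub FH)) i0 i0F.
- by [].
- move=> i /(fintype.subsetP (proper_sub LF)); rewrite FE => /eqP cFi.
  by rewrite mulmxN_entry cFi oppr0.
- by move: i0F; rewrite FE mulmxN_entry => /eqP ->; rewrite oppr0.
- by exists j => //; move: jF; rewrite FE mulmxN_entry oppr_gt0 lt_neqAle cF_le0 andbT.
exists K; split => //; first exact: fintype.subset_trans GL (proper_sub LK).
  by apply: contra i0K => /eqP ->.
have dimLF : (\dim (vanishing L) <= (\dim (vanishing F)).+1)%N.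
  rewrite leqNgt; apply/negP => /(facial_chain fL fF LF)[M [fM LM MF]].
  have PM : P M by rewrite /P MF (fintype.subset_trans GL (proper_sub LM)) andbT (asboolT fM).
  by have := Lmax M PM; rewrite /= leqNgt proper_card.
have dimFH : (\dim (vanishing F) <= (\dim (vanishing H)).+1)%N.
  rewrite leqNgt; apply/negP => /(facial_chain fF fH FH)[M [fM FM MH]].
  have QM : Q M by rewrite /Q FM (asboolT fM).
  by have := Hmin M QM; rewrite /= leqNgt proper_card.
apply/eqP; rewrite eqn_leq -ltnS (leq_trans (facial_dim_lt fL LK) dimLF) /=.
exact: leq_trans dimFH (facial_dim_lt fK KH).
Qed.

(** The subspace [U] stands for a system of equations on the solution.  Induction on
    [K]: first solve the system with the row [i] turned into an
    equation.  A solution is pushed slightly into the half-space of [i].  A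
    certificate only holds modulo the row [i]; if its coefficient has the right
    sign it is completed by [i], and otherwise it shows that every solution of the
    system without [i] also solves the inequality of [i]. *)
Lemma motzkin_transposition K (U : {vspace 'cV[R]_d}) :
  (exists2 c, c \in U & {in K, forall i, (A *m c) i 0 < 0}) \/
  (exists h : 'cV[R]_n, [/\ forall i, 0 <= h i 0, forall i, i \notin K -> h i 0 = 0,
     h != 0 & A^T *m h \in orthogonal_compl U]).
Proof.
have [k] := ubnP #|K|; elim: k => // k IH in K U *; rewrite ltnS => cardK.
have [->|[i iK]] := set_0Vmem K.
  by left; exists 0; rewrite ?mem0v // => i; rewrite inE.
have cardK' : (#|K :\ i| < k)%N by rewrite (leq_trans _ cardK) // [in X in (_ <= X)%N](cardsD1 i) iK.
have KE j : j \in K -> j = i \/ j \in K :\ i.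
  by move=> jK; have [->|ji] := eqVneq j i; [left|right; rewrite !inE ji].
pose a := A^T *m delta_mx i 0 : 'cV[R]_d.
have aE c : dot c a = (A *m c) i 0 by rewrite dot_trmx dot_delta.
have lift_h (h : 'cV[R]_n) :
    [/\ forall i, 0 <= h i 0, forall j, j \notin K :\ i -> h j 0 = 0,
      h != 0 & A^T *m h \in orthogonal_compl U] ->
    exists h : 'cV[R]_n,
    [/\ forall i, 0 <= h i 0, forall i, i \notin K -> h i 0 = 0,
      h != 0 & A^T *m h \in orthogonal_compl U].
  by move=> [h_ge0 hK h0 hU]; exists h; split=> // j jK; apply: hK; rewrite !inE negb_and jK orbT.
have [[c cU cK]|[h [h_ge0 hK h0]]] := IH (K :\ i) (U :&: orthogonal_compl <[a]>)%VS cardK'.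
  move: cU; rewrite memv_cap => /andP[cU /orthogonal_complP/(_ a (memv_line a))].
  rewrite dotC aE => ci.
  have [[b bU bi]|nob] := pselect (exists2 b, b \in U & (A *m b) i 0 < 0).
    left; have [|e e_gt0 small] := @small_perturbation R _ (mem (K :\ i))
        (fun j => - (A *m c) j 0) (fun j => (A *m b) j 0).
      by move=> j jK; rewrite oppr_gt0 cK.
    exists (c + e *: b); first by rewrite memvD ?memvZ.
    move=> j /KE[->|/small]; rewrite mulmxDZ_entry; first by rewrite ci add0r pmulr_rlt0.
    by rewrite ltr_norml => /andP[_]; lra.
  right; exists (delta_mx i 0); split.
  - by move=> j; rewrite mxE; case: (_ && _).
  - by move=> j jK; rewrite mxE; case: eqP => // ji; rewrite ji iK in jK.
  - by apply/negP => /eqP/matrixP/(_ i 0)/eqP; rewrite !mxE !eqxx oner_eq0.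
  - apply/orthogonal_complP => b bU; rewrite aE; apply/eqP; case: ltgtP => // bi.
      by case: nob; exists b.
    by case: nob; exists (- b); rewrite ?memvN // mulmxN_entry oppr_lt0.
rewrite orthogonal_compl_capE orthogonal_complK => /memv_addP[u uU [_ /vlineP[t ->]]] Ah.
have [t_le0|t_gt0] := lerP t 0.
  right; exists (h - t *: delta_mx i 0); split.
  - by move=> j; rewrite !mxE; have := h_ge0 j; case: (_ && _); rewrite ?mulr1 ?mulr0; lra.
  - move=> j jK; rewrite !mxE hK ?inE ?negb_and ?jK ?orbT //; case: eqP => [ji|_].
      by rewrite ji iK in jK.
    by rewrite mulr0 subr0.
  - apply: contra h0 => /eqP/matrixP hE; apply/eqP/matrixP => j l; rewrite !ord1 [RHS]mxE.
    have [->|ji] := eqVneq j i; first by rewrite hK // !inE eqxx.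
    by have := hE j 0; rewrite !mxE (negbTE ji) mulr0 subr0.
  - by rewrite mulmxBr -scalemxAr Ah addrK.
have [[c cU cK]|[h' hh']] := IH (K :\ i) U cardK'; last by right; exact: lift_h hh'.
left; exists c => // j /KE[->|]; last exact: cK.
have : dot c (A^T *m h) < 0.
  rewrite dot_trmx /dot; have [l hl] : exists l, h l 0 != 0.
    apply: contrapT => nl; case/eqP: h0; apply/matrixP => l j'; rewrite !ord1 [RHS]mxE.
    by apply/eqP; apply: contrapT => /negP hl; apply: nl; exists l.
  have lK : l \in K :\ i by apply: contraR hl => /hK ->.
  have Acj j' : (A *m c) j' 0 * h j' 0 <= 0.
    have [/cK cj|/hK ->] := boolP (j' \in K :\ i); last by rewrite mulr0.
    by have := h_ge0 j'; nra.
  rewrite (bigD1 l) //= ltr_nwDl ?sumr_le0 // nmulr_rlt0 ?cK //.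
  by rewrite lt_neqAle eq_sym hl h_ge0.
by rewrite Ah dotDr dotZr aE (orthogonal_complP _ _ uU) // add0r pmulr_rlt0.
Qed.

End Facial.

(** * Direction spaces and faces of the marginal cone *)

Section Direction.
Variable R : realType.

Definition direction n (X : set 'cV[R]_n) : {vspace 'cV[R]_n} :=
  linear_span [set x - y | x in X & y in X].

Lemma orthogonal_directionP n (X : set 'cV[R]_n) v :
  v \in orthogonal_compl (direction X) <->
  forall x y, X x -> X y -> dot v x = dot v y.
Proof.
rewrite orthogonal_compl_linear_span; split=> [vX x y Xx Xy|vX _ [x Xx [y Xy <-]]].
  by apply/eqP; rewrite -subr_eq0 -dotBr dotC vX //; exists x => //; exists y.
by rewrite dotC dotBr (vX x y) ?subrr.
Qed.

Lemma direction_mem n (X : set 'cV[R]_n) x y : X x -> X y -> x - y \in direction X.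
Proof.
by move=> Xx Xy; have [+ _] := linear_spanP [set x - y | x in X & y in X]; apply; exists x => //; exists y.
Qed.

End Direction.

Section MarginalCone.
Variables (R : realType) (n d : nat) (A : 'M[R]_(n, d)).
Implicit Types (J K : {set 'I_n}) (t c v : 'cV[R]_d) (w : 'cV[R]_n).

Definition subcone J : set 'cV[R]_d :=
  [set t | exists w, [/\ forall i, 0 <= w i 0, forall i, i \notin J -> w i 0 = 0
                       & t = A^T *m w]].

Lemma row_delta i : (row i A)^T = A^T *m delta_mx i 0.
Proof. by rewrite rowE trmx_mul trmx_delta. Qed.

Lemma dot_row i v : dot v (row i A)^T = (A *m v) i 0.
Proof. by rewrite row_delta dot_trmx dot_delta. Qed.

Lemma marginal_coneE : marginal_cone A = subcone [set: 'I_n]%SET.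
Proof.
have coneE w : A^T *m w = \sum_i w i 0 *: (row i A)^T.
  apply/matrixP => j k; rewrite !ord1 mxE summxE; apply: eq_bigr => i _.
  by rewrite !mxE mulrC.
apply/seteqP; split => t [w].
  move=> [w_ge0 ->]; exists (\col_i w i); split=> [i|i|].
  - by rewrite mxE.
  - by rewrite inE.
  - by rewrite coneE; apply: eq_bigr => i _; rewrite mxE.
by move=> [w_ge0 _ ->]; exists (w ^~ 0); split; rewrite ?coneE.
Qed.

Lemma subconeT J : subcone J `<=` marginal_cone A.
Proof. by rewrite marginal_coneE => t [w [w_ge0 _ ->]]; exists w; split=> // i; rewrite inE. Qed.

Lemma subcone0 J : subcone J 0.
Proof. by exists 0; split => [i|i _|]; rewrite ?mulmx0 ?mxE. Qed.

Lemma subcone_row J i : i \in J -> subcone J (row i A)^T.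
Proof.
move=> iJ; exists (delta_mx i 0); split => [j|j jJ|]; rewrite ?row_delta // mxE.
  by case: (_ && _).
by case: eqP => // ji; rewrite ji iJ in jJ.
Qed.

Lemma subconeD J s t : subcone J s -> subcone J t -> subcone J (s + t).
Proof.
move=> [w [w0 wJ ->]] [w' [w'0 w'J ->]]; exists (w + w'); rewrite mulmxDr; split=> // i.
  by rewrite mxE addr_ge0.
by move=> iJ; rewrite mxE wJ ?w'J ?addr0.
Qed.

(** A sum of terms of one sign vanishes only termwise. *)
Lemma dot_eq0_support c w : (forall i, (A *m c) i 0 <= 0) ->
  (forall i, 0 <= w i 0) -> dot c (A^T *m w) = 0 ->
  forall i, (A *m c) i 0 != 0 -> w i 0 = 0.
Proof.
move=> c_le0 w_ge0; rewrite dot_trmx => /eqP; rewrite -oppr_eq0 /dot -sumrN => /eqP sum0 i ci.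
have term_ge0 j : true -> 0 <= - ((A *m c) j 0 * w j 0).
  by move=> _; rewrite oppr_ge0 mulr_le0_ge0.
have all0 := psumr_eq0P term_ge0 sum0; have /eqP := all0 i isT.
by rewrite oppr_eq0 mulf_eq0 (negbTE ci) => /eqP.
Qed.

Lemma dot_le0 c t : (forall i, (A *m c) i 0 <= 0) -> marginal_cone A t -> dot c t <= 0.
Proof.
move=> c_le0; rewrite marginal_coneE => -[w [w_ge0 _ ->]].
by rewrite dot_trmx; apply: sumr_le0 => i _; rewrite mulr_le0_ge0.
Qed.

Lemma subconeE J c : (forall i, (A *m c) i 0 <= 0) ->
  (forall i, (i \in J) = ((A *m c) i 0 == 0)) ->
  subcone J = [set t | marginal_cone A t /\ forall u, marginal_cone A u -> dot c u <= dot c t].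
Proof.
move=> c_le0 JE; apply/seteqP; split=> t.
  move=> Jt; split=> [|u Cu]; first exact: subconeT Jt.
  case: Jt => w [w_ge0 wJ ->]; rewrite [X in _ <= X](_ : _ = 0) ?dot_le0 //.
  rewrite dot_trmx /dot big1 // => i _; case: (boolP (i \in J)) => [|/wJ ->]; last by rewrite mulr0.
  by rewrite JE => /eqP ->; rewrite mul0r.
move=> [Ct tmax]; have ct0 : dot c t = 0.
  apply/eqP; rewrite eq_le dot_le0 //= -(dot0r c); apply: tmax.
  by rewrite marginal_coneE; exact: subcone0.
move: Ct ct0; rewrite marginal_coneE => -[w [w_ge0 _ ->]] /(dot_eq0_support c_le0 w_ge0) w0.
by exists w; split=> // i; rewrite JE; exact: w0.
Qed.

Lemma facial_face J : facial A J -> face (marginal_cone A) (subcone J).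
Proof.
by move=> [c c_le0 JE]; split; [exists 0; exact: subcone0 | exists c; exact: subconeE].
Qed.

Lemma facial_set_subcone J : facial A J -> facial_set A (subcone J) = J.
Proof.
move=> [c c_le0 JE]; apply/setP => i; rewrite inE; apply/asboolP/idP; last exact: subcone_row.
rewrite (subconeE c_le0 JE) => -[_ /(_ 0)]; rewrite dot0r dot_row JE => ci.
by rewrite eq_le c_le0 ci // marginal_coneE; exact: subcone0.
Qed.

Lemma face_facial G : face (marginal_cone A) G ->
  exists2 J, facial A J & G = subcone J.
Proof.
move=> [[t0 Gt0] [c GE]]; move: Gt0; rewrite GE => -[Ct0 t0max].
have ct0 : dot c t0 = 0.
  apply/eqP; rewrite eq_le; apply/andP; split; last first.
    by rewrite -(dot0r c); apply: t0max; rewrite marginal_coneE; exact: subcone0.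
  (* a maximum over a cone cannot be positive, or doubling would exceed it *)
  have := t0max (t0 + t0); rewrite dotDr gerDl; apply.
  by move: Ct0; rewrite marginal_coneE => Ct0; exact: subconeD.
have c_le0 i : (A *m c) i 0 <= 0.
  by rewrite -dot_row -ct0; apply: t0max; rewrite marginal_coneE; apply: subcone_row; rewrite inE.
exists [set i | (A *m c) i 0 == 0]%SET; first by exists c => // i; rewrite inE.
by rewrite (subconeE c_le0) // => i; rewrite inE.
Qed.

(** Since [0] belongs to the cone, a functional constant on it is zero on it. *)
Lemma vanishing_direction J : orthogonal_compl (direction (subcone J)) = vanishing A J.
Proof.
apply/vspaceP => v; apply/idP/idP.
  move=> /orthogonal_directionP vJ; apply/vanishingP => i iJ.
  by rewrite -dot_row -(dot0r v); apply: vJ; [exact: subcone_row|exact: subcone0].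
move=> /vanishingP vJ; apply/orthogonal_directionP.
suff v0 x : subcone J x -> dot v x = 0 by move=> x y /v0 -> /v0 ->.
move=> [w [_ wJ ->]]; rewrite dot_trmx /dot big1 // => i _.
by case: (boolP (i \in J)) => [/vJ ->|/wJ ->]; rewrite ?mul0r ?mulr0.
Qed.

Lemma affdim_subcone J : (affdim (subcone J) + \dim (vanishing A J))%N = d.
Proof. by rewrite -vanishing_direction dim_orthogonal_compl. Qed.

(** If [c] exposes the face and [v] vanishes on it, then [c] and [c + e *: v] are
    both normal vectors for small [e], and [v] is a multiple of their difference. *)
Lemma normal_span_subcone J : facial A J -> normal_span A (subcone J) = vanishing A J.
Proof.
move=> [c c_le0 JE]; have [spanN Nspan] := linear_spanP (normal_cone (marginal_cone A) (subcone J)).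
have C0 : marginal_cone A 0 by rewrite marginal_coneE; exact: subcone0.
have normal v : {in J, forall i, (A *m v) i 0 = 0} -> (forall i, (A *m v) i 0 <= 0) ->
    normal_cone (marginal_cone A) (subcone J) v.
  move=> vJ v_le0 t [w [w_ge0 wJ ->]] u Cu; rewrite [X in _ <= X](_ : _ = 0) ?dot_le0 //.
  rewrite dot_trmx /dot big1 // => i _.
  by case: (boolP (i \in J)) => [/vJ ->|/wJ ->]; rewrite ?mul0r ?mulr0.
apply/eqP; rewrite eqEsubv; apply/andP; split.
  apply: Nspan => v vN; apply/vanishingP => i iJ; apply/eqP; rewrite eq_le -dot_row.
  apply/andP; split.
    have := vN 0 (subcone0 J) (row i A)^T; rewrite dot0r; apply.
    by apply: subconeT (subcone_row iJ).
  by have := vN _ (subcone_row iJ) 0 C0; rewrite dot0r.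
apply/subvP => v /vanishingP vJ.
have [|e e_gt0 small] := @small_perturbation R _ [pred i | i \notin J]
    (fun i => - (A *m c) i 0) (fun i => (A *m v) i 0).
  by move=> i /=; rewrite JE oppr_gt0 lt_neqAle c_le0 andbT.
have cJ : {in J, forall i, (A *m c) i 0 = 0} by move=> i; rewrite JE => /eqP.
have -> : v = e^-1 *: ((c + e *: v) - c).
  by rewrite addrC addKr scalerA mulVf ?scale1r // gt_eqF.
rewrite memvZ // memvB // spanN //; apply: normal => // i.
  by move=> iJ; rewrite mulmxDZ_entry cJ // vJ // mulr0 addr0.
rewrite mulmxDZ_entry; have [iJ|/small] := boolP (i \in J).
  by rewrite cJ // vJ // mulr0 addr0.
by rewrite ltr_norml => /andP[_]; lra.
Qed.

End MarginalCone.

(** * The slice of nonnegative tables and its faces *)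

Lemma continuous_dot (R : realType) n (c : 'cV[R]_n) :
  continuous (dot c : 'cV[R]_n -> R).
Proof.
have -> : dot c = fun t => \sum_(i <- index_enum 'I_n) c i 0 * t i 0 by [].
elim: (index_enum _) => [|i s IH] t.
  by rewrite (_ : (fun _ => _) = cst 0); [exact: cst_continuous | apply/funext => u; rewrite big_nil].
rewrite (_ : (fun _ => _) = (fun u : 'cV[R]_n => c i 0 * u i 0) +
    (fun u : 'cV[R]_n => \sum_(j <- s) c j 0 * u j 0)); last first.
  by apply/funext => u; rewrite big_cons.
apply: continuousD; last exact: IH.
by apply: continuousM; [exact: cst_continuous | exact: coord_continuous].
Qed.

Section ColumnSpan.
Variables (R : realType) (n k : nat).

Lemma colspanE (A : 'M[R]_(n, k)) : colspan A = limg (mxfun A).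
Proof.
apply/eqP; rewrite eqEsubv; apply/andP; split.
  apply/span_subvP => _ /mapP[j _ ->]; apply/memv_imgP; exists (delta_mx j 0); first exact: memvf.
  by rewrite lfunE /= colE.
apply/subvP => _ /memv_imgP[v _ ->]; rewrite lfunE /=.
have -> : A *m v = \sum_j v j 0 *: col j A.
  apply/matrixP => i l; rewrite !ord1 mxE summxE; apply: eq_bigr => j _.
  by rewrite !mxE mulrC.
apply: memv_suml => j _; apply/memvZ/memv_span/mapP; exists j => //.
exact: mem_enum.
Qed.

End ColumnSpan.

Lemma full_column_rank (R : realType) n d (A : 'M[R]_(n, d)) :
  \rank A = d -> lker (mxfun A) = 0%VS.
Proof.
move=> rankA; apply/eqP; rewrite -subv0; apply/subvP => v.
rewrite memv_ker lfunE /= memv0 => /eqP Av; rewrite -(inj_eq (can_inj (@trmxK _ _ _))) trmx0.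
have freeA : row_free A^T by rewrite /row_free mxrank_tr rankA.
by rewrite -(mulmx_free_eq0 _ freeA) -trmx_mul Av trmx0.
Qed.

(** The points that the restricted measure charges. *)
Definition face_atom (R : realType) n d m (A : 'M[R]_(n, d)) (V : 'M[R]_(n, m))
    (FV : set 'cV[R]_d) (t : 'cV[R]_d) :=
  exists x : counts n, [/\ sampling_set V x, FV t & t = A^T *m realcounts R x].

Section Slice.
Variables (R : realType) (n d m : nat).
Variables (A : 'M[R]_(n, d)) (N : {vspace 'cV[R]_n}) (V : 'M[R]_(n, m)).
Hypothesis A_rank : \rank A = d.
Hypothesis N_le : (N <= colspan A)%VS.
Hypothesis V_basis : columns_basis V N.
Hypothesis HA0 : A0 V.
Hypothesis HA2 : A2 V.

Let Z := (mxfun A @^-1: N)%VS.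

Definition slice : set 'cV[R]_n :=
  [set x : 'cV[R]_n | (forall i, 0 <= x i 0) /\ V^T *m x = const_mx 1].

Lemma dim_preim_sampling : \dim Z = m.
Proof.
rewrite -[RHS](size_basis V_basis) -[in RHS](lpreimK (f := mxfun A) (W := N)) -?colspanE //.
by rewrite limg_dim_eq // full_column_rank ?capv0.
Qed.

Lemma sampling_spaceE : N = limg (mxfun V).
Proof.
by rewrite -colspanE; have /andP[/eqP] := V_basis.
Qed.

(** A functional in [Z] is a combination of the sampling constraints. *)
Lemma constraint_constant z : z \in Z -> exists kappa, forall x : 'cV[R]_n,
  V^T *m x = const_mx 1 -> dot z (A^T *m x) = kappa.
Proof.
rewrite -memv_preim sampling_spaceE => /memv_imgP[u _]; rewrite !lfunE /= => zE.
by exists (dot u (const_mx 1)) => x Vx; rewrite dot_trmx zE -dot_trmx Vx.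
Qed.

Lemma constraint_dot (x y : 'cV[R]_n) : (forall z, z \in Z -> dot z (A^T *m x) = dot z (A^T *m y)) ->
  V^T *m x = V^T *m y.
Proof.
move=> xy; apply/matrixP => j k; rewrite !ord1.
have colj (h : 'cV[R]_n) : (V^T *m h) j 0 = dot (col j V) h.
  by rewrite mxE /dot; apply: eq_bigr => i _; rewrite !mxE.
have colN : col j V \in N.
  rewrite sampling_spaceE; apply/memv_imgP; exists (delta_mx j 0); rewrite ?memvf //.
  by rewrite lfunE /= colE.
have /memv_imgP[z _ zE] : col j V \in limg (mxfun A).
  by rewrite -colspanE (subvP N_le).
have zZ : z \in Z by rewrite -memv_preim -zE.
by have := xy z zZ; rewrite !colj zE lfunE /= !dot_trmx.
Qed.

Lemma realcounts_slice x : sampling_set V x -> slice (realcounts R x).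
Proof. by move=> Sx; split => // i; rewrite mxE ler0n. Qed.

(** This is where the sampling polyhedron must be the hull of its integer points. *)
Lemma slice_conv x : slice x -> exists k (w : 'I_k -> R) (s : 'I_k -> counts n),
  [/\ forall j, 0 <= w j, \sum_j w j = 1, forall j, sampling_set V (s j)
    & A^T *m x = \sum_j w j *: (A^T *m realcounts R (s j))].
Proof.
move=> Px; have : [set x : 'cV[R]_n | (forall i, 0 <= x i 0) /\ V^T *m x = const_mx 1] x by [].
rewrite HA2 => -[k [w [p [w_ge0 w1 pS ->]]]].
have [j|s sP] := @boolp.choice _ _ (fun j y => sampling_set V y /\ realcounts R y = p j).
  by have [y Sy yp] := pS j; exists y.
exists k, w, s; split => // [j|]; first by case: (sP j).
rewrite mulmx_sumr; apply: eq_bigr => j _; rewrite -scalemxAr.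
by case: (sP j) => _ ->.
Qed.

Lemma slice_support x : slice x -> convex_support A V (A^T *m x).
Proof.
move=> /slice_conv[k [w [s [w_ge0 w1 sS ->]]]]; apply: subset_closure.
by exists k, w, (fun j => A^T *m realcounts R (s j)); split => // j; exists (s j).
Qed.

(** The functionals in [Z] are constant on the hull of the sufficient statistics,
    hence on its closure. *)
Lemma support_constant z t x : z \in Z -> convex_support A V t -> slice x ->
  dot z t = dot z (A^T *m x).
Proof.
move=> zZ; have [kappa zkappa] := constraint_constant zZ; move=> Ct [_ /zkappa ->].
have closedK : closed (dot z @^-1` [set kappa]).
  apply: preimage_closed; first by move=> u _; exact: continuous_dot.
  exact: closed_eq.
suff : closure (dot z @^-1` [set kappa]) t by rewrite -((closure_id _).1 closedK).
apply: closureS Ct => u [k [w [p [_ w1 pS ->]]]] /=.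
rewrite dot_sumr -[RHS]mul1r -w1 mulr_suml; apply: eq_bigr => j _.
by rewrite dotZr; case: (pS j) => y [Sy1] <-; rewrite zkappa.
Qed.

Section Face.
Variables (FV F : set 'cV[R]_d) (dF : nat).
Hypothesis FV_face : face (convex_support A V) FV.
Hypothesis FV_dim : affdim FV = dF.
Hypothesis F_face : unique_face (marginal_cone A) (m + dF)%N FV F.

Let J := facial_set A F.
Let K := vanishing A J.

Lemma facial_set_face : facial A J /\ F = subcone A J.
Proof.
have [/face_facial[J' fJ' FE] _ _ _] := F_face.
by rewrite /J FE facial_set_subcone.
Qed.

Lemma dim_vanishing_face : (m + dF + \dim K)%N = d.
Proof.
have [fJ FE] := facial_set_face; have [_ <- _ _] := F_face.
by rewrite {1}FE affdim_subcone.
Qed.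

Lemma normal_span_face : normal_span A F = K.
Proof. by have [fJ FE] := facial_set_face; rewrite FE normal_span_subcone. Qed.

(** The face [F] puts a point of [FV] in the marginal cone, which provides a
    nonnegative table; the functionals in [Z] force its constraints.  In this way
    the closure in the convex support is dealt with without showing that the hull
    is closed. *)
Lemma face_slice t : FV t -> exists x,
  [/\ slice x, forall i, i \notin J -> x i 0 = 0 & t = A^T *m x].
Proof.
move=> Ft; have [_ FE] := facial_set_face; have [_ _ FVF _] := F_face.
have [x [x_ge0 xJ tE]] : subcone A J t by rewrite -FE; exact: FVF.
exists x; split=> //; split=> //.
have [y /realcounts_slice sy] := HA0.
have [_ <-] := sy; apply: constraint_dot => z zZ; rewrite -tE.
apply: support_constant => //.
by have [_ [c FVE]] := FV_face; move: Ft; rewrite FVE => -[].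
Qed.

(** The face [FV] read on the slice: the tables over it maximize a functional. *)
Lemma face_functional : exists c kappa,
  (forall x, slice x -> dot c (A^T *m x) <= kappa) /\
  (forall x, slice x -> FV (A^T *m x) <-> dot c (A^T *m x) = kappa).
Proof.
have [[t0 Ft0] [c FVE]] := FV_face; exists c, (dot c t0).
move: Ft0; rewrite FVE => -[Ct0 t0max]; split=> x /slice_support Cx; first exact: t0max.
split=> [[_ xmax]|cx]; first by apply/eqP; rewrite eq_le t0max // xmax.
by split=> // u Cu; rewrite cx t0max.
Qed.

Lemma face_support x : slice x -> FV (A^T *m x) -> forall i, i \notin J -> x i 0 = 0.
Proof.
move=> [x_ge0 _] Fx i iJ; have [[c c_le0 JE] FE] := facial_set_face; have [_ _ FVF _] := F_face.
have := FVF _ Fx; rewrite FE (subconeE c_le0 JE) => -[Cx xmax].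
apply: (dot_eq0_support c_le0 x_ge0 _ (i := i)); last by rewrite -JE.
apply/eqP; rewrite eq_le (dot_le0 c_le0) //= -(dot0r c); apply: xmax.
by rewrite marginal_coneE; exact: subcone0.
Qed.

(** The midpoint of two tables over [FV] is again over [FV] and has the union of
    their supports, so a support of maximal size contains all the others. *)
Lemma exists_interior_point : exists x, [/\ slice x, FV (A^T *m x) &
  forall y, slice y -> FV (A^T *m y) -> forall i, 0 < y i 0 -> 0 < x i 0].
Proof.
pose P k := `[< exists x, [/\ slice x, FV (A^T *m x) & #|[set i | (0 < x i 0)%R]%SET| = k] >].
have exP : exists k, P k.
  have [[t Ft] _] := FV_face; have [x [sx _ tE]] := face_slice Ft.
  by exists #|[set i | (0 < x i 0)%R]%SET|; apply/asboolP; exists x; rewrite -tE.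
have P_le k : P k -> (k <= n)%N.
  by move=> /asboolP[x [_ _ <-]]; rewrite -[X in (_ <= X)%N]card_ord max_card.
case: (ex_maxnP exP P_le) => k /asboolP[x [sx Fx xk]] kmax.
exists x; split=> // y sy Fy i yi.
pose z := 2^-1 *: (x + y).
have zE j : z j 0 = 2^-1 * (x j 0 + y j 0) by rewrite !mxE.
have dotz c : dot c (A^T *m z) = 2^-1 * (dot c (A^T *m x) + dot c (A^T *m y)).
  by rewrite -scalemxAr dotZr mulmxDr dotDr.
have [x_ge0 Vx] := sx; have [y_ge0 Vy] := sy.
have sz : slice z.
  split=> [j|]; first by rewrite zE mulr_ge0 ?invr_ge0 // addr_ge0.
  rewrite -scalemxAr mulmxDr Vx Vy; apply/matrixP => j l; rewrite !mxE; lra.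
have Fz : FV (A^T *m z).
  have [c [kappa [_ FVE]]] := face_functional.
  apply/FVE => //; rewrite dotz ((FVE x sx).1 Fx) ((FVE y sy).1 Fy); lra.
have /kmax : P #|[set i | (0 < z i 0)%R]%SET| by apply/asboolP; exists z.
rewrite -xk => card_le.
have xz : [set i | (0 < x i 0)%R]%SET \subset [set i | (0 < z i 0)%R]%SET.
  apply/fintype.subsetP => j; rewrite !inE zE => xj.
  by rewrite mulr_gt0 ?invr_gt0 // ltr_pwDl.
have /eqP/setP/(_ i) : [set i | (0 < x i 0)%R]%SET == [set i | (0 < z i 0)%R]%SET.
  by rewrite eqEcard xz.
by rewrite !inE zE => ->; rewrite mulr_gt0 ?invr_gt0 // ltr_wpDl.
Qed.

Section InteriorPoint.
Variable x : 'cV[R]_n.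
Hypothesis slice_x : slice x.
Hypothesis face_x : FV (A^T *m x).
Hypothesis x_max : forall y, slice y -> FV (A^T *m y) -> forall i, 0 < y i 0 -> 0 < x i 0.

Let J0 := [set i | (0 < x i 0)%R]%SET.

Lemma slice_perturbation (h : 'cV[R]_n) :
  (forall i, i \notin J0 -> 0 <= h i 0) -> V^T *m h = 0 ->
  exists2 e, 0 < e & slice (x + e *: h).
Proof.
have [x_ge0 Vx] := slice_x; move=> h_ge0 Vh.
have [|e e_gt0 small] := @small_perturbation R _ [pred i | i \in J0] (fun i => x i 0) (fun i => h i 0).
  by move=> i /=; rewrite inE.
exists e => //; split=> [i|]; last by rewrite mulmxDr -scalemxAr Vh scaler0 addr0.
rewrite !mxE; have [/small|/h_ge0 hi] := boolP (i \in J0).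
  by rewrite ltr_norml => /andP[]; lra.
by rewrite addr_ge0 // mulr_ge0 // ltW.
Qed.

(** The table can be moved both ways along [h], so the functional exposing [FV]
    does not change along [h]. *)
Lemma direction_interior (h : 'cV[R]_n) :
  (forall i, i \notin J0 -> h i 0 = 0) -> V^T *m h = 0 -> A^T *m h \in direction FV.
Proof.
move=> h0 Vh; have [|//|e e_gt0 sxh] := @slice_perturbation h.
  by move=> i /h0 ->.
have [||e' e'_gt0 sxh'] := @slice_perturbation (- h).
- by move=> i /h0 hi; rewrite mxE hi oppr0.
- by rewrite mulmxN Vh oppr0.
have [c [kappa [c_le FVE]]] := face_functional.
have dotE a (g : 'cV[R]_n) : dot c (A^T *m (x + a *: g)) = kappa + a * dot c (A^T *m g).
  by rewrite mulmxDr -scalemxAr dotDr dotZr ((FVE x slice_x).1 face_x).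
have ch : dot c (A^T *m h) = 0.
  apply/eqP; rewrite eq_le; have := c_le _ sxh; have := c_le _ sxh'.
  rewrite !dotE mulmxN linearN /= mulrN gerDl oppr_le0 pmulr_rge0 // => ->.
  by rewrite gerDl pmulr_rle0 // andbT.
have Fxh : FV (A^T *m (x + e *: h)) by apply/FVE => //; rewrite dotE ch mulr0 addr0.
have := direction_mem Fxh face_x; rewrite mulmxDr addrC addKr -scalemxAr.
by move=> eh; rewrite -[A^T *m h](scalerK (lt0r_neq0 e_gt0)) memvZ.
Qed.

(** By Motzkin's theorem, if [J0] is not facial then some vector with zero sufficient
    statistic is nonnegative off [J0] and nonzero there; adding a small multiple of
    it to [x] would enlarge the support. *)
Lemma support_facial : facial A J0.
Proof.
have J0n i : i \notin J0 -> x i 0 = 0.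
  rewrite inE -leNgt => xi; apply/eqP; rewrite eq_le xi /=; exact: slice_x.1.
have [[c cU cJ]|[h [h_ge0 hJ h_neq0 hU]]] := motzkin_transposition A (~: J0)%SET (vanishing A J0).
  move/vanishingP in cU; exists c => i; have [iJ|iJ] := boolP (i \in J0).
  - by rewrite cU.
  - by rewrite ltW // cJ // inE.
  - by rewrite cU // eqxx.
  - by rewrite lt_eqF // cJ // inE.
have [h' h'J hE] := orthogonal_vanishing hU.
case/eqP: h_neq0; apply/matrixP => i j; rewrite !ord1 [RHS]mxE.
have [iJ|iJ] := boolP (i \in J0); first by apply: hJ; rewrite inE negbK.
have A0 : A^T *m (h - h') = 0 by rewrite mulmxBr hE subrr.
have V0 : V^T *m (h - h') = 0.
  rewrite -[RHS](mulmx0 _ V^T); apply: constraint_dot => z _.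
  by rewrite A0 mulmx0.
have [|//|e e_gt0 sxh] := @slice_perturbation (h - h').
  by move=> k kJ; rewrite !mxE h'J // subr0.
have Fxh : FV (A^T *m (x + e *: (h - h'))).
  by rewrite mulmxDr -scalemxAr A0 scaler0 addr0.
apply/eqP; apply: contraT => hi; move: (iJ); rewrite inE => /negP; case; apply: (x_max sxh Fxh).
rewrite !mxE (J0n i iJ) (h'J i iJ) subr0 add0r mulr_gt0 // lt_neqAle eq_sym hi; exact: h_ge0.
Qed.

(** Dually, a vector orthogonal to [Z] and to the functionals vanishing on [J0] is
    the statistic of a direction that is supported by [J0] and respects the
    constraints. *)
Lemma orthogonal_direction_interior :
  (orthogonal_compl (direction FV) <= Z + vanishing A J0)%VS.
Proof.
rewrite -[X in (_ <= X)%VS]orthogonal_complK; apply: orthogonal_complS.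
rewrite orthogonal_compl_add; apply/subvP => u; rewrite memv_cap => /andP[uZ].
move=> /orthogonal_vanishing[h hJ uE]; rewrite uE; apply: direction_interior => //.
rewrite -[RHS](mulmx0 _ V^T); apply: constraint_dot => z zZ.
by rewrite mulmx0 dot0r -uE; exact: (orthogonal_complP _ _ uZ).
Qed.

End InteriorPoint.

(** On [FV], the functionals of [Z] are constant and those of [K] are zero. *)
Lemma nonident_orthogonal : (Z + K <= orthogonal_compl (direction FV))%VS.
Proof.
apply/subvP => _ /memv_addP[z zZ [v vK ->]]; apply/orthogonal_directionP.
have [kappa zkappa] := constraint_constant zZ; move/vanishingP in vK.
suff dotE t : FV t -> dot (z + v) t = kappa by move=> s t /dotE -> /dotE ->.
move=> /face_slice[x [[_ Vx] xJ ->]]; rewrite dotDl zkappa // dot_trmx [X in _ + X]/dot.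
rewrite big1 ?addr0 // => i _.
by have [/vK ->|/xJ ->] := boolP (i \in J); rewrite ?mul0r ?mulr0.
Qed.

Lemma dim_orthogonal_direction : (dF + \dim (orthogonal_compl (direction FV)))%N = d.
Proof. by rewrite -{1}FV_dim dim_orthogonal_compl. Qed.

Lemma dim_orthogonal_direction_face :
  \dim (orthogonal_compl (direction FV)) = (m + \dim K)%N.
Proof.
apply: (@addnI dF); rewrite dim_orthogonal_direction addnA (addnC dF).
exact/esym/dim_vanishing_face.
Qed.

(** The support [J0] of a maximal table over [FV] either is the facial set of [F],
    and a dimension count applies, or is strictly smaller.  In the second case a
    proper [F] would not be the only face of its dimension above [FV]. *)
Lemma sampling_cap_vanishing : (Z :&: K = 0)%VS.
Proof.
have [x [slice_x face_x x_max]] := exists_interior_point.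
have fJ0 := support_facial slice_x face_x x_max.
set J0 := [set i | (0 < x i 0)%R]%SET in fJ0.
have [fJ FE] := facial_set_face.
have J0J : J0 \subset J.
  apply/fintype.subsetP => i; rewrite inE => xi; apply: contraLR (xi) => iJ.
  by rewrite (face_support slice_x face_x) // ltxx.
have [J0E|J0_neq] := eqVneq J0 J.
  have := orthogonal_direction_interior slice_x face_x; rewrite -/J0 J0E -/K => /dimvS le.
  have := dimv_sum_cap Z K; rewrite dim_preim_sampling => sum_cap.
  apply/eqP; rewrite -dimv_eq0 -leqn0 -(leq_add2l (\dim (Z + K))) sum_cap addn0.
  by rewrite -dim_orthogonal_direction_face.
have [JT|JT] := eqVneq J [set: 'I_n]%SET.
  have -> : K = 0%VS.
    apply/eqP; rewrite -subv0; apply/subvP => v /vanishingP vK.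
    rewrite -(full_column_rank A_rank) memv_ker lfunE /=; apply/eqP/matrixP => i j.
    by rewrite !ord1 [RHS]mxE vK // JT inE.
  by rewrite capv0.
have J0_proper : J0 \proper J by rewrite finset.properEneq J0_neq.
have [J' [fJ' J0J' J'J dimE]] := facial_diamond fJ0 fJ J0_proper JT.
case/eqP: J'J; have [_ _ _ F_unique] := F_face.
rewrite -(facial_set_subcone fJ') /J; congr facial_set; apply: F_unique.
- exact: facial_face.
- apply/eqP; rewrite -(eqn_add2r (\dim K)) dim_vanishing_face -[X in (_ + X)%N]dimE.
  by rewrite affdim_subcone.
- move=> t /[dup] Ft /face_slice[y [[y_ge0 Vy] _ tE]]; rewrite tE in Ft *.
  exists y; split=> // i iJ'; apply/eqP; apply: contraT => yi.
  have yi_gt0 : 0 < y i 0 by rewrite lt_neqAle eq_sym yi y_ge0.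
  have : i \in J0 by rewrite inE; exact: x_max yi_gt0.
  by move=> /(fintype.subsetP J0J'); rewrite (negbTE iJ').
Qed.

(** The inclusion of the left side is an equality by dimensions, since the sum of
    [Z] and [K] is direct. *)
Lemma nonident_direction : nonident A N F = orthogonal_compl (direction FV).
Proof.
apply/eqP; rewrite /nonident normal_span_face eqEdim nonident_orthogonal /=.
rewrite dimv_disjoint_sum ?sampling_cap_vanishing // -[X in (_ <= X + _)%N]/(\dim Z).
by rewrite dim_preim_sampling dim_orthogonal_direction_face.
Qed.

Lemma dim_nonident : \dim (nonident A N F) = (m + \dim (normal_span A F))%N.
Proof.
by rewrite /nonident normal_span_face dimv_disjoint_sum ?sampling_cap_vanishing // -dim_preim_sampling.
Qed.

(** A convex combination reaches the maximum of the functional exposing [FV] only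
    if all its points with positive weight do. *)
Lemma face_atom_conv t : FV t -> exists k (w : 'I_k -> R) (p : 'I_k -> 'cV[R]_d),
  [/\ forall j, 0 <= w j, \sum_j w j = 1, forall j, 0 < w j -> face_atom A V FV (p j)
    & t = \sum_j w j *: p j].
Proof.
move=> /[dup] Ft /face_slice[x [sx _ tE]]; rewrite tE in Ft *.
have [c [kappa [c_le FVE]]] := face_functional.
have [k [w [s [w_ge0 w1 sS xE]]]] := slice_conv sx.
exists k, w, (fun j => A^T *m realcounts R (s j)); split=> // j wj.
have s_slice l : slice (realcounts R (s l)) := realcounts_slice (sS l).
exists (s j); split => //; apply/FVE => //.
have gap_ge0 l : true -> 0 <= w l * (kappa - dot c (A^T *m realcounts R (s l))).
  by move=> _; rewrite mulr_ge0 // subr_ge0 c_le.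
have gap0 : \sum_l w l * (kappa - dot c (A^T *m realcounts R (s l))) = 0.
  under eq_bigr do rewrite mulrBr; rewrite sumrB -mulr_suml w1 mul1r.
  under [X in _ - X]eq_bigr do rewrite -dotZr.
  by rewrite -dot_sumr -xE ((FVE x sx).1 Ft) subrr.
have gaps := psumr_eq0P gap_ge0 gap0; have /eqP := gaps j isT.
by rewrite mulf_eq0 gt_eqF //= subr_eq0 eq_sym => /eqP.
Qed.

Lemma exists_face_atom : exists t, face_atom A V FV t.
Proof.
have [[t Ft] _] := FV_face; have [k [w [p [w_ge0 w1 atom_p _]]]] := face_atom_conv Ft.
apply: contrapT => no_atom; have w0 j : w j = 0.
  apply/eqP; rewrite eq_le w_ge0 andbT leNgt; apply/negP => /atom_p at_p.
  by apply: no_atom; exists (p j).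
by move: w1; under eq_bigr do rewrite w0; rewrite big1 // => /esym/eqP; rewrite oner_eq0.
Qed.

(** A functional constant on the atoms is constant on their convex combinations. *)
Lemma direction_face_atom : direction (face_atom A V FV) = direction FV.
Proof.
rewrite -[LHS]orthogonal_complK -[RHS]orthogonal_complK; congr orthogonal_compl.
apply/vspaceP => v; apply/idP/idP => /orthogonal_directionP vX; apply/orthogonal_directionP.
  have [a at_a] := exists_face_atom.
  suff va t : FV t -> dot v t = dot v a by move=> t t' /va -> /va ->.
  move=> /face_atom_conv[k [w [p [w_ge0 w1 atom_p ->]]]]; rewrite dot_sumr.
  rewrite -[RHS]mul1r -w1 mulr_suml; apply: eq_bigr => j _; rewrite dotZr.
  have := w_ge0 j; rewrite le_eqVlt => /orP[/eqP <-|/atom_p at_p]; first by rewrite !mul0r.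
  by rewrite (vX _ a at_p).
by move=> t t' [x [_ Ft _]] [x' [_ Ft' _]]; exact: vX.
Qed.

Lemma closed_face : closed FV.
Proof.
have [[t0 Ft0] [c FVE]] := FV_face; have [Ct0 t0_max] : convex_support A V t0 /\
  forall u, convex_support A V u -> dot c u <= dot c t0 by rewrite FVE in Ft0.
have -> : FV = convex_support A V `&` dot c @^-1` [set r | dot c t0 <= r].
  rewrite FVE; apply/seteqP; split=> t [Ct t_max]; split=> //=; first exact: t_max.
  by move=> u /t0_max/le_trans; apply.
apply: closedI; first exact: closed_closure.
apply: preimage_closed; first by move=> u _; exact: continuous_dot.
exact: closed_ge.
Qed.

End Face.
End Slice.

(** * Summability of the Poisson weights *)

Section PoissonSums.
Variable R : realType.

(** The exponential series of a nonnegative number increases to its sum. *)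
Lemma exp_partial_sum_le (y : R) M : 0 <= y ->
  \sum_(k < M) y ^+ k / k`!%:R <= expR y.
Proof.
move=> y_ge0; rewrite -(big_mkord xpredT (fun k => y ^+ k / k`!%:R)).
rewrite -[X in X <= _]/(series (exp_coeff y) M); apply: nondecreasing_cvgn_le.
  apply/nondecreasing_seqP => k; rewrite /series /= big_nat_recr //= lerDl.
  by rewrite /exp_coeff divr_ge0 // exprn_ge0.
exact: is_cvg_series_exp_coeff.
Qed.

(** Finitely many tables lie in a common box, over which the sum of products is
    the product of partial exponential sums. *)
Lemma poisson_sum_le n (y : 'I_n -> R) (s : seq 'cV[nat]_n) :
  (forall i, 0 <= y i) -> uniq s ->
  \sum_(x <- s) \prod_i (y i ^+ x i ord0 / (x i ord0)`!%:R) <= \prod_i expR (y i).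
Proof.
move=> y_ge0 s_uniq; pose M := \max_(x <- s) \max_i x i ord0.
have x_le x i : x \in s -> ((x : 'cV[nat]_n) i ord0 < M.+1)%N.
  move=> xs; rewrite ltnS; apply: leq_trans (leq_bigmax_seq _ xs isT).
  exact: (@leq_bigmax _ (fun i => x i ord0)).
pose h (x : 'cV[nat]_n) := [ffun i => inord (x i ord0) : 'I_M.+1].
pose G (f : {ffun 'I_n -> 'I_M.+1}) := \prod_i (y i ^+ f i / (f i)`!%:R).
have G_ge0 f : 0 <= G f by apply: prodr_ge0 => i _; rewrite divr_ge0 // exprn_ge0.
have h_inj : {in s &, injective h}.
  move=> x x' xs x's /ffunP hxx'; apply/matrixP => i j; rewrite !ord1.
  by have := hxx' i; rewrite !ffunE => /(congr1 val); rewrite /= !inordK ?x_le.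
have -> : \sum_(x <- s) \prod_i (y i ^+ x i ord0 / (x i ord0)`!%:R) = \sum_(f <- map h s) G f.
  rewrite big_map; apply: eq_big_seq => x xs; apply: eq_bigr => i _.
  by rewrite ffunE inordK ?x_le.
rewrite big_uniq ?map_inj_in_uniq //=.
apply: (@le_trans _ _ (\sum_f G f)).
  by rewrite [leRHS](bigID (mem (map h s))) /= lerDl sumr_ge0.
rewrite -(bigA_distr_bigA (fun i (j : 'I_M.+1) => y i ^+ j / j`!%:R)); apply: ler_prod => i _; rewrite exp_partial_sum_le // andbT.
by apply: sumr_ge0 => k _; rewrite divr_ge0 // exprn_ge0.
Qed.

Lemma integral_singleton d (T : measurableType d) (mu : {measure set T -> \bar R})
    (t : T) (f : T -> \bar R) : measurable [set t] ->
  (\int[mu]_(x in [set t]) f x = f t * mu [set t])%E.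
Proof.
move=> mt; rewrite -integral_cst //; apply: eq_integral => x.
by rewrite inE /= => ->.
Qed.

End PoissonSums.

Section CountMeasure.
Variables (R : realType) (n d m : nat) (A : 'M[R]_(n, d)) (V : 'M[R]_(n, m)).

(** The countable set of tables carries the discrete sigma-algebra. *)
Lemma measurable_counts (B : set (counts n)) : measurable B.
Proof. exact: sub_sigma_algebra. Qed.

Lemma measurable_counts_fun d' (T : measurableType d') (f : counts n -> T) :
  measurable_fun setT f.
Proof. by move=> _ B _; exact: measurable_counts. Qed.

Lemma nu_singleton (x : counts n) :
  nu V [set x] = if x \in sampling_set V then (poisson_weight R x)%:E else 0%E.
Proof.
rewrite /nu esum_mkcondr esum_set1 //; case: ifP => // _.
by rewrite lee_fin; apply: prodr_ge0 => i _; rewrite invr_ge0.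
Qed.

Lemma nu_singleton_le (x : counts n) : (nu V [set x] <= (poisson_weight R x)%:E)%E.
Proof.
rewrite nu_singleton; case: ifP => // _.
by rewrite lee_fin; apply: prodr_ge0 => i _; rewrite invr_ge0.
Qed.

Lemma poisson_weight_expR theta (x : counts n) :
  expR (dot (suffstat A x) theta) * poisson_weight R x =
  \prod_i (expR ((A *m theta) i 0) ^+ x i ord0 / (x i ord0)`!%:R).
Proof.
rewrite big_split /= dotC dot_trmx /dot expR_sum; congr (_ * _).
by apply: eq_bigr => i _; rewrite [realcounts _ _ _ _]mxE mulr_natr -mulr_natl expRM_natl.
Qed.

(** Tables are countable, so the integral is a series; its partial sums run over
    distinct tables and are bounded by a product of exponentials.  The measure is
    only asked to be dominated by the Poisson weights at points, so that the
    restriction to a face is covered too. *)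
Lemma exp_suffstat_integral_lty (rho : {measure set (counts n) -> \bar R}) theta :
  (forall x, rho [set x] <= (poisson_weight R x)%:E)%E ->
  (\int[rho]_x (expR (dot (suffstat A x) theta))%:E < +oo)%E.
Proof.
move=> rho_le; pose f (x : counts n) := (expR (dot (suffstat A x) theta))%:E.
pose b (x : 'cV[nat]_n) := \prod_i (expR ((A *m theta) i 0) ^+ x i ord0 / (x i ord0)`!%:R).
pose E k : set (counts n) := [set x | pickle (x : 'cV[nat]_n) = k].
have UE : \bigcup_k E k = setT by apply/seteqP; split => // x _; exists (pickle (x : 'cV[nat]_n)).
rewrite -UE ge0_integral_bigcup //=; first last.
- by apply/trivIsetP => i j _ _ ij; apply/seteqP; split => // x [xi xj]; move: ij; rewrite -xi -xj eqxx.
- by rewrite UE => _ B _; exact: measurable_counts.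
- by move=> k; exact: measurable_counts.
(* codes that represent no table contribute an empty set, hence the default 0 *)
have term_le k : (\int[rho]_(x in E k) f x <=
    (oapp b 0 (@pickle_inv 'cV[nat]_n k))%:E)%E.
  case xk : (@pickle_inv 'cV[nat]_n k) => [x|] /=.
    have -> : E k = [set (x : counts n)].
      apply/seteqP; split => [z zk|_ ->]; have := @pickle_invK 'cV[nat]_n k; rewrite xk //=.
      by rewrite -zk => /(pcan_inj (@pickleK 'cV[nat]_n)).
    rewrite integral_singleton; last exact: measurable_counts.
    by rewrite /= /b -poisson_weight_expR EFinM lee_wpmul2l // lee_fin expR_ge0.
  have -> : E k = set0.
    by apply/seteqP; split => // z zk; move: xk; rewrite -zk pickleK_inv.
  by rewrite integral_set0.
apply: (@le_lt_trans _ _ (\prod_i expR (expR ((A *m theta) i 0)))%:E); last by rewrite ltry.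
apply: lime_le.
  by apply: is_cvg_nneseries => k _ _; apply: integral_ge0 => x _; rewrite lee_fin expR_ge0.
apply: nearW => k; rewrite big_mkord.
apply: (@le_trans _ _ (\sum_(i < k) (oapp b 0 (@pickle_inv 'cV[nat]_n i))%:E)%E).
  by apply: lee_sum => i _; exact: term_le.
rewrite sumEFin lee_fin -(big_mkord xpredT (fun i => oapp b 0 (@pickle_inv 'cV[nat]_n i))).
have := @poisson_sum_le R n (fun i => expR ((A *m theta) i 0))
  (pmap (@pickle_inv 'cV[nat]_n) (index_iota 0 k)) (fun i => expR_ge0 _).
rewrite big_pmap => -> //; apply: pmap_uniq; [exact: pickle_invK|exact: iota_uniq].
Qed.

End CountMeasure.

(** * Borel measurability of linear maps *)

Section Borel.
Variables (R : realType) (k : nat).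

Lemma closed_borel (B : set 'cV[R]_k) : closed B -> measurable (B : set (borel R k)).
Proof.
move=> cB; rewrite -[B]setCK; apply: measurableC.
by apply: sub_sigma_algebra; exact: closed_openC.
Qed.

Lemma continuous_borel (f : 'cV[R]_k -> R) : continuous f ->
  measurable_fun setT (f : borel R k -> R).
Proof.
move=> /continuousP cf; apply: (measurability _ (measurable_realfun.RGenOpens.measurableE R)).
move=> _ [_ [a [b ->] <-]]; rewrite setTI; apply: sub_sigma_algebra.
exact/cf/interval_open.
Qed.

Lemma measurable_dot (c : 'cV[R]_k) : measurable_fun setT (dot c : borel R k -> R).
Proof. by apply: continuous_borel; exact: continuous_dot. Qed.

Lemma measurable_singleton (t : borel R k) : measurable [set t].
Proof.
have -> : [set t] = \bigcap_(i in [set: 'I_k]) [set u : borel R k | (u : 'cV[R]_k) i 0 = (t : 'cV[R]_k) i 0].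
  apply/seteqP; split => [_ -> //|u ut]; apply/matrixP => i j; rewrite !ord1.
  exact: ut.
apply: fin_bigcap_measurable => // i _; apply: closed_borel.
apply: (@preimage_closed _ _ (fun u : 'cV[R]_k => u i 0) [set (t : 'cV[R]_k) i 0]).
  by move=> u _; exact: coord_continuous.
exact: closed_eq.
Qed.

Lemma measurable_mulmx p (B : 'M[R]_(p, k)) :
  measurable_fun setT (mulmx B : borel R k -> borel R p).
Proof.
have /continuousP contB : continuous (mulmx B : 'cV[R]_k -> 'cV[R]_p).
  move=> u S [P nP PS].
  have : \forall v \near u, forall i, P i 0 ((B *m v) i 0).
    apply: (@filter_forall _ 'I_p (fun i v => P i 0 ((B *m v) i 0)) (nbhs u)) => i.
    have : nbhs u (dot (row i B)^T @^-1` P i 0).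
      by apply: (@continuous_dot _ _ (row i B)^T u (P i 0)); rewrite dotC dot_row; exact: nP.
    by apply: filterS => v; rewrite /preimage /= dotC dot_row.
  by apply: filterS => v Pv; apply: PS => i j; rewrite !ord1.
apply: (@measurability _ _ (borel R k) (borel R p) setT (mulmx B) (@open 'cV[R]_p)) => //.
move=> _ [S oS <-].
by rewrite setTI; apply: sub_sigma_algebra; exact: contB.
Qed.

End Borel.

(** * The exponential family carried by a face *)

Section FaceMeasure.
Variables (R : realType) (n d m : nat) (A : 'M[R]_(n, d)) (V : 'M[R]_(n, m)).
Variable FV : set 'cV[R]_d.
Local Open Scope ereal_scope.

Definition face_measure (B : set (borel R d)) : \bar R := mu A V (B `&` FV).

Let D : set (counts n) := suffstat A @^-1` FV.
Let nuF : {measure set (counts n) -> \bar R} := mrestr (nu V) (measurable_counts D).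

Let face_measureE B : face_measure B = nuF (suffstat A @^-1` B).
Proof. by []. Qed.

Let face_measure0 : face_measure set0 = 0.
Proof. by rewrite face_measureE preimage_set0 measure0. Qed.

Let face_measure_ge0 B : 0 <= face_measure B.
Proof. by rewrite face_measureE measure_ge0. Qed.

Let face_measure_sigma_additive : semi_sigma_additive face_measure.
Proof.
move=> F mF tF mUF; rewrite face_measureE preimage_bigcup.
apply: measure_semi_sigma_additive.
- by move=> k; exact: measurable_counts.
- apply/trivIsetP => /= i j _ _ ij; rewrite -preimage_setI.
  by move/trivIsetP : tF => /(_ _ _ _ _ ij) ->//; rewrite preimage_set0.
- exact: measurable_counts.
Qed.

HB.instance Definition _ := isMeasure.Build _ _ _
  face_measure face_measure0 face_measure_ge0 face_measure_sigma_additive.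

Lemma measurable_exp_dot (theta : 'cV[R]_d) (a : R) (B : set (borel R d)) :
  measurable B -> measurable_fun B ((fun t => (expR (dot t theta - a))%:E) : borel R d -> \bar R).
Proof.
move=> mB; apply: measurable_funTS; apply: measurableT_comp => //.
apply: measurableT_comp => //; apply: measurable_funB; last exact: measurable_cst.
by under eq_fun do rewrite dotC; exact: measurable_dot.
Qed.

Lemma measurable_exp_dot0 (theta : 'cV[R]_d) (B : set (borel R d)) :
  measurable B -> measurable_fun B ((fun t => (expR (dot t theta))%:E) : borel R d -> \bar R).
Proof.
by move=> mB; have := @measurable_exp_dot theta 0 B mB; under eq_fun do rewrite subr0.
Qed.

Lemma face_integral_lty theta :
  \int[face_measure]_t (expR (dot t theta))%:E < +oo.
Proof.
rewrite -[face_measure]/(pushforward nuF (suffstat A)) ge0_integral_pushforward //.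
- rewrite preimage_setT; apply: exp_suffstat_integral_lty => x.
  apply: le_trans (nu_singleton_le V x); apply: le_measure; rewrite ?inE; try exact: measurable_counts.
  exact: subIsetl.
- exact: measurable_counts_fun.
- exact: measurable_exp_dot0.
Qed.

Let face_fin_num : fin_num_fun face_measure.
Proof.
move=> B mB; rewrite ge0_fin_numE //; apply: le_lt_trans (face_integral_lty 0).
rewrite (_ : (fun _ => _) = cst 1).
  rewrite integral_cst // mul1e; apply: le_measure; rewrite ?inE //.
by apply/funext => t; rewrite dot0r expR0.
Qed.

HB.instance Definition _ := @Measure_isFinite.Build _ (borel R d) R face_measure face_fin_num.

Lemma face_atom_gt0 t : face_atom A V FV t -> 0 < face_measure [set t].
Proof.
move=> [x [Sx Ft tE]]; apply: (@lt_le_trans _ _ (nu V [set x])).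
  rewrite nu_singleton (mem_set Sx) lte_fin; apply: prodr_gt0 => i _.
  by rewrite invr_gt0 ltr0n fact_gt0.
apply: le_measure; rewrite ?inE; try exact: measurable_counts.
by move=> _ ->; split=> /=; rewrite /suffstat -tE.
Qed.

Hypothesis FV_atom : exists t, face_atom A V FV t.
Hypothesis measurable_FV : measurable (FV : set (borel R d)).

Let P := extended_family A V FV.

Let total theta := \int[face_measure]_t (expR (dot t theta))%:E.

Lemma total_gt0 theta : 0 < total theta.
Proof.
have [t at_t] := FV_atom.
apply: (@lt_le_trans _ _ (\int[face_measure]_(u in [set t]) (expR (dot u theta))%:E)).
  rewrite integral_singleton; last exact: measurable_singleton.
  by rewrite mule_gt0 ?face_atom_gt0 // lte_fin expR_gt0.
apply: ge0_subset_integral => //.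
- exact: measurable_singleton.
- exact: measurable_exp_dot0.
Qed.

Lemma expR_log_partition theta :
  (expR (log_partition face_measure theta))%:E = total theta.
Proof.
have tot_gt0 := total_gt0 theta; have tot_lty := face_integral_lty theta.
have tot_fin : total theta \is a fin_num by rewrite ge0_fin_numE // ltW.
by rewrite /log_partition lnK ?fineK // posrE fine_gt0 // tot_gt0.
Qed.

Lemma face_ae : {ae face_measure, forall t, FV t}.
Proof.
exists (~` FV); split; first exact: measurableC.
  by rewrite /face_measure setICl /mu /pushforward preimage_set0 measure0.
by [].
Qed.

Lemma face_ae_eq (B : set (borel R d)) (f g : borel R d -> \bar R) :
  (forall t, FV t -> f t = g t) -> ae_eq face_measure B f g.
Proof. by move=> fg; apply: negligibleS face_ae; apply: subsetC => t Ft _; exact: fg. Qed.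

(** All that matters about the log-partition function is that its exponential is
    the total integral. *)
Lemma extended_family_density : exists psi : 'cV[R]_d -> R,
  (forall theta, (expR (psi theta))%:E = total theta) /\
  (forall theta B, P theta B = \int[face_measure]_(t in B) (expR (dot t theta - psi theta))%:E).
Proof. by exists (log_partition face_measure); split=> // theta; exact: expR_log_partition. Qed.

(** The ratio of the two exponential factors is constant on [FV], and the
    normalization removes the constant. *)
Lemma extended_family_eq theta1 theta2 kappa :
  (forall t, FV t -> dot t theta1 = (dot t theta2 + kappa)%R) ->
  same_distr (P theta1) (P theta2).
Proof.
have [psi [psi_total PE]] := extended_family_density.
move=> diff B mB; rewrite !PE.
have psiE : psi theta1 = (psi theta2 + kappa)%R.
  apply: expR_inj; apply: EFin_inj; rewrite expRD EFinM !psi_total /total.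
  rewrite -ge0_integralZr //; first last.
  - exact: measurable_exp_dot0.
  apply: ae_eq_integral => //.
  - exact: measurable_exp_dot0.
  - by apply: emeasurable_funM; [exact: measurable_exp_dot0 | exact: measurable_cst].
  - by apply: face_ae_eq => t Ft; rewrite diff // expRD EFinM.
apply: ae_eq_integral => //; try exact: measurable_exp_dot.
by apply: face_ae_eq => t Ft; rewrite diff // psiE opprD addrACA subrr addr0.
Qed.

Lemma extended_family_atom : exists psi : 'cV[R]_d -> R, forall t, face_atom A V FV t ->
  exists2 p, (0 < p)%R &
  forall theta, P theta [set t] = (expR (dot t theta - psi theta) * p)%:E.
Proof.
have [psi [_ PE]] := extended_family_density; exists psi => t at_t.
have fin_t : face_measure [set t] \is a fin_num.
  by apply: fin_num_measure; exact: measurable_singleton.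
exists (fine (face_measure [set t])).
  by rewrite fine_gt0 // face_atom_gt0 //= -ge0_fin_numE.
move=> theta; rewrite PE integral_singleton; last exact: measurable_singleton.
by rewrite EFinM fineK.
Qed.

(** At an atom, equal probabilities force equal log-densities. *)
Lemma extended_family_inj theta1 theta2 : same_distr (P theta1) (P theta2) ->
  forall t t', face_atom A V FV t -> face_atom A V FV t' ->
  dot (theta1 - theta2) t = dot (theta1 - theta2) t'.
Proof.
have [psi atomP] := extended_family_atom.
move=> same; suff h t : face_atom A V FV t -> dot (theta1 - theta2) t = (psi theta1 - psi theta2)%R.
  by move=> t t' /h -> /h ->.
move=> /atomP[p p_gt0 pE]; have := same _ (measurable_singleton t); rewrite !pE.
move=> [] /(mulIf (lt0r_neq0 p_gt0)) /expR_inj; rewrite dotBl (dotC theta1) (dotC theta2); lra.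
Qed.

(** Both densities are positive at an atom.  Taking logarithms, the mass terms
    cancel between [theta] and [0], and the normalizing constants between the two
    atoms. *)
Lemma representation_pairing k' : expfam_representation P k' ->
  exists (tau : 'cV[R]_d -> 'cV[R]_k') (eta : 'cV[R]_d -> 'cV[R]_k'),
  forall t t' theta, face_atom A V FV t -> face_atom A V FV t' ->
    dot (t - t') theta = dot (tau t - tau t') (eta theta - eta 0%R).
Proof.
have [psi atomP] := extended_family_atom.
move=> [lam [tau [eta [phi [mtau rep]]]]]; exists tau, eta => t t' theta at_t at_t'.
suff affine (u : borel R d) : face_atom A V FV u -> exists q, forall th,
    (dot u th - psi th = dot (tau u) (eta th) - phi th + q)%R.
  have [q qE] := affine t at_t; have [q' q'E] := affine t' at_t'.
  have := qE theta; have := q'E theta; have := qE 0%R; have := q'E 0%R.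
  rewrite !dotBl !dotBr !dot0r; lra.
move=> /atomP[p p_gt0 pE]; have mu1 := measurable_singleton u.
have repu th : (expR (dot u th - psi th) * p)%:E =
    (expR (dot (tau u) (eta th) - phi th))%:E * lam [set u].
  by rewrite -pE rep // integral_singleton.
have [l l_gt0 lE] : exists2 l, (0 < l)%R & lam [set u] = l%:E.
  have lam_ge0 : 0 <= lam [set u] by exact: measure_ge0.
  have := repu 0%R; have e_gt0 := expR_gt0 (dot (tau u) (eta 0%R) - phi 0%R).
  case: (lam [set u]) lam_ge0 => [l l_ge0| |] //.
    rewrite -EFinM => -[] h; exists l => //.
    by rewrite -(pmulr_rgt0 _ e_gt0) -h mulr_gt0 // expR_gt0.
  by rewrite mulry gtr0_sg // mul1e.
exists (ln l - ln p)%R => th; have := repu th.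
by rewrite lE -EFinM => -[] /(congr1 (@ln R)); rewrite !lnM ?posrE ?expR_gt0 // !expRK; lra.
Qed.

(** Only the component of [theta] in the direction space of [FV] affects the
    density, the other one being constant on [FV]; inner products with a basis of
    that space are thus a sufficient statistic. *)
Lemma extended_family_representation :
  expfam_representation P (\dim (direction FV)).
Proof.
pose U := direction FV.
have [psi [_ PE]] := extended_family_density.
have [t0 Ft0] : exists t, FV t by have [t [x [_ Ft _]]] := FV_atom; exists t.
have [th|proj projP] := @boolp.choice _ _ (fun theta u => u \in U /\ theta - u \in orthogonal_compl U)%R.
  have : th \in (U + orthogonal_compl U)%VS.
    by rewrite orthogonal_compl_sum memvf.
  move=> /memv_addP[u uU [v vU ->]]; exists u; split=> //.
  by rewrite addrAC subrr add0r.
pose E := (\matrix_(j < \dim U, i < d) (vbasis U)`_j i ord0)%R.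
have EE t j : ((E *m t) j ord0 = dot (vbasis U)`_j t)%R.
  by rewrite mxE; apply: eq_bigr => i _; rewrite mxE.
pose eta (theta : 'cV[R]_d) := (\col_(j < \dim U) coord (vbasis U) j (proj theta))%R.
exists face_measure, (mulmx E), eta,
  (fun theta => psi theta - dot t0 (theta - proj theta))%R.
split; first exact: measurable_mulmx.
move=> theta B mB; rewrite PE.
apply: ae_eq_integral => //; first exact: measurable_exp_dot.
  apply: measurable_funTS; apply: measurableT_comp => //.
  apply: measurableT_comp => //; apply: measurable_funB; last exact: measurable_cst.
  under eq_fun do rewrite dotC.
  apply: (@measurableT_comp _ _ _ _ _ _ (dot (eta theta) : borel R _ -> R)).
    exact: measurable_dot.
  exact: measurable_mulmx.
apply: face_ae_eq => t Ft; congr (expR _)%:E.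
have [pU pV] := projP theta.
have -> : dot (E *m t) (eta theta) = dot t (proj theta).
  rewrite (coord_vbasis pU) dot_sumr; apply: eq_bigr => j _.
  by rewrite EE mxE dotZr mulrC (dotC t).
have := (orthogonal_directionP FV (theta - proj theta)).1 pV t t0 Ft Ft0.
by rewrite !(dotC (theta - proj theta)%R) !dotBr; lra.
Qed.

End FaceMeasure.

(** * Lower bound on the dimension of a representation *)

Section Pairing.
Variable R : realType.

(** A free family of elements of [Y] of maximal length spans. *)
Lemma linear_span_basis (E : vectType R) (Y : set E) :
  exists s : seq E, (forall x, x \in s -> Y x) /\ basis_of (linear_span Y) s.
Proof.
pose P r := `[< exists s : seq E, [/\ forall x, x \in s -> Y x, free s & size s = r] >].
have exP : exists r, P r by exists 0; apply/asboolP; exists [::]; rewrite nil_free.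
have P_le r : P r -> (r <= \dim (fullv : {vspace E}))%N.
  by move=> /asboolP[s [_ /eqP <- <-]]; rewrite dimvS ?subvf.
case: (ex_maxnP exP P_le) => r /asboolP[s [sY free_s size_s]] r_max.
have [Yspan spanY] := linear_spanP Y.
exists s; split=> //; rewrite /basis_of free_s andbT eqEsubv; apply/andP; split.
  by apply/span_subvP => x /sY; exact: Yspan.
apply: spanY => y Yy; apply: contraT => ys.
have /r_max : P r.+1.
  apply/asboolP; exists (y :: s); rewrite free_cons ys free_s /= size_s; split=> // x.
  by rewrite inE => /orP[/eqP -> //|/sY].
by rewrite ltnn.
Qed.

(** A matrix whose rows form a basis of the direction space of [X] is read off by
    taking [theta] in the canonical basis; the pairing factors it through a space
    of dimension [k]. *)
Lemma pairing_dim d k (X : set 'cV[R]_d) (tau : 'cV[R]_d -> 'cV[R]_k)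
    (eta : 'cV[R]_d -> 'cV[R]_k) :
  (forall t t' theta, X t -> X t' ->
    dot (t - t') theta = dot (tau t - tau t') (eta theta - eta 0)) ->
  (\dim (direction X) <= k)%N.
Proof.
move=> pairing; have [s [sX /[dup] s_basis /andP[_ free_s]]] :=
  linear_span_basis [set x - y | x in X & y in X].
rewrite (size_basis (X := in_tuple s) s_basis).
have pts (j : 'I_(size s)) : exists tt : 'cV[R]_d * 'cV[R]_d,
    [/\ X tt.1, X tt.2 & s`_j = tt.1 - tt.2].
  by have [|t Xt [t' Xt' <-]] := sX s`_j; [exact: mem_nth | exists (t, t')].
have [//|p pP] := @boolp.choice _ _ (fun (j : 'I_(size s)) (tt : 'cV[R]_d * 'cV[R]_d) =>
    [/\ X tt.1, X tt.2 & s`_j = tt.1 - tt.2]).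
pose B := \matrix_(j < size s, i < d) s`_j i 0.
pose S := \matrix_(j < size s, l < k) (tau (p j).1 - tau (p j).2) l 0.
pose H := \matrix_(l < k, i < d) (eta (delta_mx i 0) - eta 0) l 0.
have BE : B = S *m H.
  apply/matrixP => j i; have [X1 X2 sE] := pP j.
  have := pairing _ _ (delta_mx i 0) X1 X2; rewrite -sE => sH.
  rewrite mxE [RHS]mxE -dot_delta.
  by rewrite sH; apply: eq_bigr => l _; rewrite /S /H !mxE.
have B_free : row_free B.
  apply/inj_row_free => v vB0.
  have sum0 : \sum_(j < size s) v 0 j *: (in_tuple s)`_j = 0.
    apply/matrixP => i l; rewrite !ord1 summxE [RHS]mxE.
    transitivity ((v *m B) 0 i); last by rewrite vB0 mxE.
    by rewrite mxE; apply: eq_bigr => j _; rewrite !mxE.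
  apply/matrixP => i j; rewrite !ord1 [RHS]mxE.
  have /freeP free0 : free (in_tuple s) by [].
  exact: (free0 (fun j => v 0 j)).
rewrite -(eqP B_free) BE; apply: leq_trans (mxrankM_maxl _ _) (rank_leq_col _).
Qed.

End Pairing.

(** * Quotient spaces and their cosets *)

Section Quotient.
Variables (K : fieldType) (E : vectType K) (W : {vspace E}).

Lemma class_linear : linear (@class K E W).
Proof. exact: (@pi_is_linear K E W). Qed.

HB.instance Definition _ := GRing.isLinear.Build K E (quotv W) *:%R (@class K E W) class_linear.

Lemma classP x y : class W x = class W y <-> x - y \in W.
Proof. by split => [/quotvP|h]; last exact/quotvP. Qed.

Lemma class_repr (c : quotv W) : class W (repr c) = c.
Proof. exact: reprK. Qed.

Lemma lker_class : lker (linfun (@class K E W)) = W.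
Proof.
apply/vspaceP => x; rewrite memv_ker lfunE /= -(linear0 (@class K E W)).
by apply/eqP/idP; [move/classP|move=> xW; apply/classP]; rewrite subr0.
Qed.

Lemma limg_class : limg (linfun (@class K E W)) = fullv.
Proof.
apply/eqP; rewrite eqEsubv subvf; apply/subvP => c _; apply/memv_imgP.
by exists (repr c); rewrite ?memvf // lfunE /= class_repr.
Qed.

Lemma dim_quotv : (\dim W + \dim {: quotv W})%N = \dim {: E}.
Proof. by rewrite -(limg_ker_dim (linfun (@class K E W)) fullv) capfv lker_class limg_class. Qed.

Lemma coset_affine (c : quotv W) : affine_subspace (coset c) (\dim W).
Proof.
exists (repr c), W; split=> //; apply/seteqP; split=> x.
  rewrite -{1}[c]class_repr => /cosetE xW; exists (x - repr c) => //.
  by rewrite addrC subrK.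
by move=> [u uW <-]; rewrite -[c in coset c]class_repr; apply/cosetE; rewrite /sim addrAC subrr add0r.
Qed.

Lemma coset_parallel (c c' : quotv W) : parallel (coset c) (coset c').
Proof.
exists (repr c' - repr c); apply/seteqP; split=> x.
  rewrite -{1}[c']class_repr => /cosetE xW; exists (x - (repr c' - repr c)); last by rewrite subrK.
  by rewrite -[c in coset c]class_repr; apply/cosetE; rewrite /sim opprB addrA addrAC addrK.
move=> [u + <-]; rewrite -{1}[c]class_repr => /cosetE uW.
rewrite -[c' in coset c']class_repr; apply/cosetE; move: uW; rewrite /sim.
by rewrite addrA addrAC addrK.
Qed.

Lemma class_factor (E' : vectType K) (h : 'Hom(E, E')) : (lker h <= W)%VS ->
  exists g : 'Hom(E', quotv W), forall x, g (h x) = class W x.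
Proof.
move=> hW; exists (linfun (@class K E W) \o h^-1)%VF => x.
rewrite comp_lfunE lfunE /=; apply/classP/(subvP hW); rewrite memv_ker linearB /=.
by rewrite limg_lfunVK ?subrr // memv_img ?memvf.
Qed.

End Quotient.

(** * Parametrization by projections on the facial set *)

Section Parametrization.
Variables (R : realType) (n d : nat) (A : 'M[R]_(n, d)).
Variables (N : {vspace 'cV[R]_n}) (F : set 'cV[R]_d).

Let J := facial_set A F.
Let LF := normal_span A F.
Let Z := (mxfun A @^-1: N)%VS.
Let W := nonident A N F.
Let M := colspan A.
Let NF := facial_subspace A N F.
Let piJ := coordproj R J.

Hypothesis N_le : (N <= M)%VS.
Hypothesis LFE : LF = vanishing A J.
Hypothesis Z_cap_LF : (Z :&: LF = 0)%VS.

Lemma image_ominusP (Y : {vspace 'cV[R]_n}) gamma :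
  gamma \in (piJ @: ominus M Y)%VS <->
  exists2 theta, mxfun A theta \in orthogonal_compl Y & gamma = piJ (mxfun A theta).
Proof.
split=> [/memv_imgP[y + ->]|[theta thetaY ->]].
  rewrite memv_cap /M colspanE => /andP[/memv_imgP[theta _ ->] thetaY].
  by exists theta.
by apply: memv_img; rewrite memv_cap thetaY /M colspanE memv_img ?memvf.
Qed.

Lemma projection_eq0 theta : piJ (mxfun A theta) = 0 <-> theta \in LF.
Proof. by rewrite LFE memv_ker comp_lfunE; split=> [->//|/eqP]. Qed.

Lemma LF_le_nonident : (LF <= W)%VS.
Proof. exact: addvSr. Qed.

Lemma Z_le_nonident : (Z <= W)%VS.
Proof. exact: addvSl. Qed.

(** Remove from [mxfun A theta] its component in [Y], which [X] can absorb. *)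
Lemma complement_representative (Y : {vspace 'cV[R]_n}) (X : {vspace 'cV[R]_d}) :
  (forall y, y \in Y -> exists2 zeta, zeta \in X & y = mxfun A zeta) ->
  forall theta, exists2 theta', mxfun A theta' \in orthogonal_compl Y & theta - theta' \in X.
Proof.
move=> YX theta; have : mxfun A theta \in (Y + orthogonal_compl Y)%VS.
  by rewrite orthogonal_compl_sum memvf.
move=> /memv_addP[y yY [z zY AE]]; have [zeta zetaX yE] := YX y yY.
exists (theta - zeta); last by rewrite subKr.
by rewrite linearB /= AE yE addrC addKr.
Qed.

Lemma sampling_preimage y : y \in N -> exists2 zeta, zeta \in Z & y = mxfun A zeta.
Proof.
move=> yN; have /memv_imgP[zeta _ yE] : y \in limg (mxfun A) by rewrite -colspanE (subvP N_le).
by exists zeta => //; rewrite -memv_preim -yE.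
Qed.

Lemma sampling_representative y : y \in N -> exists2 zeta, zeta \in W & y = mxfun A zeta.
Proof. by move=> /sampling_preimage[zeta /(subvP Z_le_nonident) zetaW ->]; exists zeta. Qed.

Lemma facial_representative y : y \in NF -> exists2 zeta, zeta \in W & y = mxfun A zeta.
Proof. by move=> /memv_imgP[zeta zetaW ->]; exists zeta. Qed.

Variable g : 'Hom('cV[R]_#|J|, Theta A N F).
Hypothesis gE : forall theta, g (piJ (mxfun A theta)) = class W theta.

Lemma image_surjective (Y : {vspace 'cV[R]_n}) :
  (forall y, y \in Y -> exists2 zeta, zeta \in W & y = mxfun A zeta) ->
  forall c, exists2 gamma, gamma \in (piJ @: ominus M Y)%VS & g gamma = c.
Proof.
move=> YW c; have [theta' thetaY' thetaW] := complement_representative YW (repr c).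
exists (piJ (mxfun A theta')); first by apply/image_ominusP; exists theta'.
by rewrite gE -[RHS]class_repr; apply/esym/classP.
Qed.

Lemma image_full (Y : {vspace 'cV[R]_n}) :
  (forall y, y \in Y -> exists2 zeta, zeta \in W & y = mxfun A zeta) ->
  (g @: (piJ @: ominus M Y))%VS = fullv.
Proof.
move=> YW; apply/eqP; rewrite eqEsubv subvf; apply/subvP => c _.
by have [gamma gammaY <-] := image_surjective YW c; rewrite memv_img.
Qed.

(** Two representatives differ by an element of [NF] that is orthogonal to [NF]. *)
Lemma injective_facial : {in (piJ @: ominus M NF)%VS &, injective g}.
Proof.
move=> _ _ /image_ominusP[theta thetaNF ->] /image_ominusP[theta' theta'NF ->].
rewrite !gE => /classP thetaW; congr (piJ _); apply/eqP.
rewrite -subr_eq0 -linearB -memv0 -(orthogonal_compl_cap NF) memv_cap memv_img //=.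
by rewrite linearB memvB.
Qed.

(** Write an element of [LF] as the sum of an element of [Z] and of some [theta]
    with [mxfun A theta] orthogonal to [N].  The projection of [theta] is in the
    kernel of [g]; injectivity puts [theta] in [LF], and the other summand is zero
    because [Z] and [LF] meet only in [0].  Conversely, the component in [Z] of a
    difference of representatives has an image both in [N] and orthogonal to it. *)
Lemma injective_sampling :
  {in (piJ @: ominus M N)%VS &, injective g} <->
  (mxfun A @: LF <= orthogonal_compl N)%VS.
Proof.
split=> [g_inj|/subvP LFN].
  apply/subvP => _ /memv_imgP[l lLF ->].
  have [theta thetaN lZ] := complement_representative sampling_preimage l.
  have thetaW : theta \in W.
    rewrite -(subKr l theta); apply: memvB.
      exact: subvP LF_le_nonident _ lLF.
    exact: subvP Z_le_nonident _ lZ.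
  have /projection_eq0 thetaLF : piJ (mxfun A theta) = 0.
    apply: g_inj; [by apply/image_ominusP; exists theta | exact: mem0v |].
    by rewrite gE linear0 -(linear0 (@class R _ W)); apply/classP; rewrite subr0.
  have : l - theta \in (Z :&: LF)%VS by rewrite memv_cap lZ memvB.
  by rewrite Z_cap_LF memv0 subr_eq0 => /eqP ->.
move=> _ _ /image_ominusP[theta thetaN ->] /image_ominusP[theta' theta'N ->].
rewrite !gE => /classP /memv_addP[z zZ [l lLF dE]].
have dN : mxfun A (theta - theta') \in orthogonal_compl N by rewrite linearB memvB.
have Az0 : mxfun A z = 0.
  apply/eqP; rewrite -memv0 -(orthogonal_compl_cap N) memv_cap memv_preim zZ /=.
  have -> : mxfun A z = mxfun A (theta - theta') - mxfun A l by rewrite dE linearD addrK.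
  by rewrite memvB // LFN // memv_img.
have /projection_eq0 l0 := lLF.
by apply/eqP; rewrite -subr_eq0 -!linearB dE !linearD /= Az0 !linear0 add0r l0.
Qed.

End Parametrization.

(** * Geometry and statistics of the extended family *)

Theorem theorem7 (R : realType) (n d m : nat)
    (A : 'M[R]_(n, d)) (N : {vspace 'cV[R]_n}) (V : 'M[R]_(n, m))
    (FV : set 'cV[R]_d) (dF : nat) (F : set 'cV[R]_d)
    (A_rows : forall i, row i A != 0)
    (A_rank : \rank A = d)
    (N_proper : (N <= colspan A)%VS /\ N != colspan A)
    (V_basis : columns_basis V N)
    (HA0 : A0 V) (HA1 : A1 N V) (HA2 : A2 V)
    (FV_face : face (convex_support A V) FV)
    (FV_dim : affdim FV = dF)
    (F_face : unique_face (marginal_cone A) (m + dF)%N FV F) :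
  let J := facial_set A F in
  let LF := normal_span A F in
  let W := nonident A N F in
  let M := colspan A in
  let NF := facial_subspace A N F in
  let piJ := coordproj R J in
  let U := (piJ @: ominus M NF)%VS in
  let U0 := (piJ @: ominus M N)%VS in
  let P := extended_family A V FV in
  (* (i) *)
  ((forall theta : 'cV[R]_d,
      affine_subspace (coset (class W theta)) (m + \dim LF)%N) /\
   (m + \dim LF = d - dF)%N /\
   \dim {: Theta A N F} = dF /\
   (forall c : Theta A N F, affine_subspace (coset c) (d - dF)%N) /\
   (forall c c' : Theta A N F, parallel (coset c) (coset c')) /\
   (exists g : 'Hom('cV[R]_#|J|, Theta A N F),
      (forall theta, g (piJ (mxfun A theta)) = class W theta) /\
      {in U &, injective g} /\ (g @: U)%VS = fullv /\
      (g @: U0)%VS = fullv /\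
      ({in U0 &, injective g} <->
       (mxfun A @: LF <= orthogonal_compl N)%VS))) /\
  (* (ii) *)
  ((forall theta1 theta2 : 'cV[R]_d,
      sim W theta1 theta2 -> same_distr (P theta1) (P theta2)) /\
   (exists Q : Theta A N F -> set (borel R d) -> \bar R,
      (forall theta, same_distr (Q (class W theta)) (P theta)) /\
      (forall c c', same_distr (Q c) (Q c') -> c = c')) /\
   (exists Q : 'cV[R]_#|J| -> set (borel R d) -> \bar R,
      (forall theta, same_distr (Q (piJ (mxfun A theta))) (P theta)) /\
      (forall theta, exists2 gamma, gamma \in U &
         same_distr (Q gamma) (P theta)) /\
      (forall gamma gamma', gamma \in U -> gamma' \in U ->
         same_distr (Q gamma) (Q gamma') -> gamma = gamma') /\
      (forall theta, exists2 gamma, gamma \in U0 &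
         same_distr (Q gamma) (P theta)) /\
      ((forall gamma gamma', gamma \in U0 -> gamma' \in U0 ->
          same_distr (Q gamma) (Q gamma') -> gamma = gamma') <->
       (mxfun A @: LF <= orthogonal_compl N)%VS)) /\
   has_order P dF).
Proof.
move=> J LF W M NF piJ U U0 P; have [N_le _] := N_proper.
have LFE : LF = vanishing A J := normal_span_face F_face.
have Z_cap_LF : ((mxfun A @^-1: N) :&: LF = 0)%VS.
  by rewrite LFE; apply: (sampling_cap_vanishing A_rank N_le V_basis HA0 HA2 FV_face FV_dim F_face).
have W_direction : W = orthogonal_compl (direction FV).
  exact: (nonident_direction A_rank N_le V_basis HA0 HA2 FV_face FV_dim F_face).
have dimW : \dim W = (m + \dim LF)%N.
  exact: (dim_nonident A_rank N_le V_basis HA0 HA2 FV_face FV_dim F_face).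
have dim_sum : (m + \dim LF + dF)%N = d.
  by rewrite LFE addnAC; exact: dim_vanishing_face F_face.
have dim_diff : (m + \dim LF)%N = (d - dF)%N by rewrite -[X in (X - _)%N]dim_sum addnK.
have dim_Theta : \dim {: Theta A N F} = dF.
  have := dim_quotv W; rewrite dim_cV dimW -[X in _ = X -> _]dim_sum; exact: addnI.
have lker_h : (lker (piJ \o mxfun A)%VF <= W)%VS by rewrite -/(vanishing A J) -LFE; exact: addvSr.
have [g' g'E] := class_factor lker_h.
pose g : 'Hom('cV[R]_#|J|, Theta A N F) := g'.
have gE theta : g (piJ (mxfun A theta)) = class W theta by rewrite -g'E comp_lfunE.
have facialNF := @facial_representative R n d A N F.
have samplingN := sampling_representative F N_le.
have full_U := image_full gE facialNF.
have full_U0 := image_full gE samplingN.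
have inj_U := injective_facial gE.
have inj_U0 := injective_sampling N_le LFE Z_cap_LF gE.
have atoms : exists t, face_atom A V FV t.
  exact: (exists_face_atom N_le V_basis HA0 HA2 FV_face F_face).
have mFV : measurable (FV : set (borel R d)) by apply: closed_borel; exact: closed_face FV_face.
have P_eq theta1 theta2 : sim W theta1 theta2 -> same_distr (P theta1) (P theta2).
  rewrite /sim W_direction => /orthogonal_directionP FV_const.
  have [t0 [_ [_ Ft0 _]]] := atoms.
  apply: (extended_family_eq atoms mFV (kappa := dot (theta1 - theta2) t0)) => t Ft.
  by rewrite -(FV_const t t0 Ft Ft0) dotBl !(dotC t); lra.
have P_inj theta1 theta2 : same_distr (P theta1) (P theta2) -> class W theta1 = class W theta2.
  move=> /(extended_family_inj atoms) same; apply/classP; rewrite W_direction.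
  rewrite -(direction_face_atom N_le V_basis HA0 HA2 FV_face F_face).
  exact/orthogonal_directionP.
have P_order : has_order P dF.
  have dimFV : \dim (direction FV) = dF := FV_dim.
  split; first by rewrite -dimFV; exact: extended_family_representation.
  move=> k' /(representation_pairing atoms)[tau [eta pairing]]; rewrite -dimFV.
  rewrite -(direction_face_atom N_le V_basis HA0 HA2 FV_face F_face).
  by apply: (pairing_dim (tau := tau) (eta := eta)) => t t' theta; exact: pairing.
(* from here on only the comparison of distributions proved above matters *)
clearbody P.
pose QTheta (c : Theta A N F) := P (repr c).
have QThetaE theta : same_distr (QTheta (class W theta)) (P theta).
  by apply: P_eq; apply/classP; rewrite class_repr.
have QTheta_inj c c' : same_distr (QTheta c) (QTheta c') -> c = c'.
  by move=> /P_inj; rewrite !class_repr.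
pose Q (gamma : 'cV[R]_#|J|) := QTheta (g gamma).
have QE theta : same_distr (Q (piJ (mxfun A theta))) (P theta) by rewrite /Q gE; exact: QThetaE.
have Q_surj (Y : {vspace 'cV[R]_n}) : (forall y, y \in Y -> exists2 zeta, zeta \in W & y = mxfun A zeta) ->
    forall theta, exists2 gamma, gamma \in (piJ @: ominus M Y)%VS & same_distr (Q gamma) (P theta).
  move=> YW theta; have [gamma gammaY gc] := image_surjective gE YW (class W theta).
  by exists gamma; rewrite // /Q gc.
have Q_eq gamma gamma' : g gamma = g gamma' -> same_distr (Q gamma) (Q gamma').
  by rewrite /Q => ->.
split; [split; [|split; [|split; [|split; [|split]]]] | split; [|split; [|split]]] => //.
- by move=> theta; rewrite -dimW; exact: coset_affine.
- by move=> c; rewrite -dim_diff -dimW; exact: coset_affine.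
- exact: coset_parallel.
- by exists g.
- by exists QTheta.
- exists Q; split=> //; split; first exact: Q_surj facialNF.
  split; first by move=> gamma gamma' gU g'U /QTheta_inj; exact: inj_U.
  split; first exact: Q_surj samplingN.
  split=> [Q_inj|/inj_U0 g_inj gamma gamma' gU g'U /QTheta_inj]; last exact: g_inj.
  by apply/inj_U0 => gamma gamma' gU g'U /Q_eq; exact: Q_inj.
Qed.
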